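(* Let $R=K[x_0,\dots,x_n]$ with $K$ an infinite field, and let $I\subset R$ be a homogeneous ideal of height at least two containing no linear forms. Then the algorithm described in the context, applied to $I$, terminates after finitely many steps, and the resulting ideal $J'$ is numerically ACM. Furthermore, the degrees of the forms $F$ used in the repeated applications of step $( * )$ are strictly increasing.
   Context: Notation: $h_{R/I}(j)=\dim_K[R/I]_j$, $\Delta h(j)=h(j)-h(j-1)$, and $\Delta^i=\Delta\circ\Delta^{i-1}$. An O-sequence is a sequence satisfying Macaulay's growth conditions, i.e. the Hilbert function of some standard graded $K$-algebra. Numerically ACM: a homogeneous ideal $J\subset R$ is numerically ACM if $R/J$ has the same Hilbert function as $R/I_Y$ for some arithmetically Cohen-Macaulay codimension two subscheme $Y\subset\mathbb P^n$ (i.e. $R/I_Y$ is Cohen-Macaulay). The algorithm. Input: a homogeneous ideal $I\subset R$ of height $\ge 2$ containing no linear forms. Let $\underline a=\Delta^{n-1}h_{R/I}=(1,a_1,\dots,a_e)$, where $a_e$ is the last non-zero value (a finite sequence, with $a_1\le 2$). Repeat the following step, replacing $I$ by the new ideal $J$ and $\underline a$ by the new sequence $\underline b$ each time, until $\underline a$ is an O-sequence: $( * )$ If $\underline a$ is not an O-sequence, set $a_{e+1}=0$ and let $i$ be the smallest index such that $a_i\le i$ and $a_i<a_{i+1}$. Let $F\in I$ be a (nonzero) form of degree $i+2$ and let $J=L\cdot I+(F)$, where $L$ is a general linear form. Set $\underline b=\Delta^{n-1}h_{R/J}$. The ideal obtained when the process stops is the result $J'$ of the algorithm. *)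

(* Defs.v *)
From mathcomp Require Import all_boot all_order all_algebra.
From mathcomp Require Import boolp classical_sets cardinality.
From mathcomp Require Import mpoly.

Set Implicit Arguments.
Unset Strict Implicit.
Unset Printing Implicit Defensive.

Import Order.TTheory GRing.Theory Num.Theory.

Local Open Scope classical_set_scope.
Local Open Scope ring_scope.

(** Ideals of K[x_0, ..., x_n] are subsets (Prop-valued predicates) of
    [{mpoly K[n.+1]}]. *)

Definition is_ideal (A : comNzRingType) (I : set A) : Prop :=
  [/\ I 0, forall f g, I f -> I g -> I (f + g) & forall r f, I f -> I (r * f)].

Definition is_prime_ideal (A : comNzRingType) (P : set A) : Prop :=
  [/\ is_ideal P, ~ P 1 & forall f g, P (f * g) -> P f \/ P g].

(* The strict chain P 0 < P 1 < ... < P k of primes; it has length k. *)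
Definition prime_chain (A : comNzRingType) (P : nat -> set A) (k : nat) : Prop :=
  (forall i, (i <= k)%N -> is_prime_ideal (P i)) /\
  (forall i, (i < k)%N -> P i `<` P i.+1).

(* The height of I is the infimum of the heights of the primes containing I;
   in particular the unit ideal has infinite height. *)
Definition height_ge (A : comNzRingType) (I : set A) (k : nat) : Prop :=
  forall Q, is_prime_ideal Q -> I `<=` Q ->
    exists P : nat -> set A, prime_chain P k /\ P k = Q.

Definition has_height (A : comNzRingType) (I : set A) (k : nat) : Prop :=
  height_ge I k /\ ~ height_ge I k.+1.

(* Primes of A/I correspond to primes of A containing I. *)
Definition quotient_dim_ge (A : comNzRingType) (I : set A) (k : nat) : Prop :=
  exists P : nat -> set A, prime_chain P k /\ I `<=` P 0%N.

Definition has_quotient_dim (A : comNzRingType) (I : set A) (k : nat) : Prop :=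
  quotient_dim_ge I k /\ ~ quotient_dim_ge I k.+1.

(* The ideal I + (f). *)
Definition ideal_adjoin (A : comNzRingType) (I : set A) (f : A) : set A :=
  [set p | exists q, I (p - q * f)].

(* Each f_i is a non-zero-divisor on A/(I, f_1, ..., f_(i-1)). *)
Fixpoint regular_on_quotient (A : comNzRingType) (I : set A) (fs : seq A) : Prop :=
  if fs is f :: fs' then
    (forall g, I (f * g) -> I g) /\ regular_on_quotient (ideal_adjoin I f) fs'
  else True.

Definition is_homogeneous_ideal (K : fieldType) (n : nat)
    (I : set {mpoly K[n.+1]}) : Prop :=
  is_ideal I /\ forall f, I f -> forall d, I (pihomog mdeg d f).

Definition irrelevant_ideal (K : fieldType) (n : nat) : set {mpoly K[n.+1]} :=
  [set f | f@_0%MM = 0].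

(* Depth of R/I with respect to the irrelevant ideal m, for a proper
   homogeneous ideal I.  The usual condition R/(I, fs) <> 0 on a regular
   sequence is then automatic, since (I, fs) is contained in m. *)
Definition quotient_depth_ge (K : fieldType) (n : nat)
    (I : set {mpoly K[n.+1]}) (k : nat) : Prop :=
  exists fs : seq {mpoly K[n.+1]},
    [/\ size fs = k, forall f, f \in fs -> @irrelevant_ideal K n f
      & regular_on_quotient I fs].

Definition has_quotient_depth (K : fieldType) (n : nat)
    (I : set {mpoly K[n.+1]}) (k : nat) : Prop :=
  quotient_depth_ge I k /\ ~ quotient_depth_ge I k.+1.

(* R/I is Cohen-Macaulay, for a proper homogeneous ideal I. *)
Definition is_CM_quotient (K : fieldType) (n : nat)
    (I : set {mpoly K[n.+1]}) : Prop :=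
  exists d, has_quotient_dim I d /\ has_quotient_depth I d.

Definition is_saturated (K : fieldType) (n : nat)
    (I : set {mpoly K[n.+1]}) : Prop :=
  forall (f : {mpoly K[n.+1]}) (k : nat),
    (forall g : {mpoly K[n.+1]}, g \is k.-homog -> I (g * f)) -> I f.

(* dim_K [R/I]_j = d: there are d forms of degree j whose classes are a
   K-basis of [R]_j / [I]_j. *)
Definition graded_quotient_dim (K : fieldType) (n : nat)
    (I : set {mpoly K[n.+1]}) (j d : nat) : Prop :=
  exists e : 'I_d -> {mpoly K[n.+1]},
    [/\ forall i, e i \is j.-homog,
        forall c : 'I_d -> K, I (\sum_i c i *: e i) -> forall i, c i = 0
      & forall f : {mpoly K[n.+1]}, f \is j.-homog ->
          exists c : 'I_d -> K, I (f - \sum_i c i *: e i)].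

Definition hilbert (K : fieldType) (n : nat)
    (I : set {mpoly K[n.+1]}) (j : nat) : nat :=
  xget 0%N [set d | graded_quotient_dim I j d].

(* First difference, with the convention h (-1) = 0. *)
Definition diff (h : nat -> int) (j : nat) : int :=
  h j - (if j is j'.+1 then h j' else 0).

(* The sequence a = Delta^(n-1) h_(R/I), extended by 0 beyond its last
   non-zero value. *)
Definition hvector (K : fieldType) (n : nat)
    (I : set {mpoly K[n.+1]}) : nat -> int :=
  iter n.-1 diff (fun j => (hilbert I j)%:Z).

(* The arithmetically Cohen-Macaulay subscheme Y of codimension two is given by
   its saturated ideal IY. *)
Definition numerically_ACM (K : fieldType) (n : nat)
    (J : set {mpoly K[n.+1]}) : Prop :=
  is_homogeneous_ideal J /\
  exists IY : set {mpoly K[n.+1]},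
    [/\ is_homogeneous_ideal IY, is_saturated IY, has_height IY 2,
        is_CM_quotient IY & forall j, hilbert J j = hilbert IY j].

(* ks = [:: k_d; k_(d-1); ...; k_s] is the d-th Macaulay representation of a:
   a = C(k_d, d) + C(k_(d-1), d-1) + ... + C(k_s, s) with
   k_d > k_(d-1) > ... > k_s >= s >= 1; it is empty when a = 0. *)
Definition macaulay_rep (d a : nat) (ks : seq nat) : Prop :=
  [/\ sorted gtn ks, (size ks <= d)%N,
      forall i, (i < size ks)%N -> (d - i <= nth 0 ks i)%N
    & a = (\sum_(i < size ks) 'C(nth 0 ks i, d - i))%N].

(* a^<d> = C(k_d + 1, d + 1) + ... + C(k_s + 1, s + 1). *)
Definition macaulay_shift (d : nat) (ks : seq nat) : nat :=
  (\sum_(i < size ks) 'C((nth 0 ks i).+1, (d - i).+1))%N.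

Definition O_sequence (a : nat -> int) : Prop :=
  exists b : nat -> nat,
    [/\ forall j, a j = (b j)%:Z, b 0%N = 1%N
      & forall d, (0 < d)%N ->
          exists2 ks, macaulay_rep d (b d) ks & (b d.+1 <= macaulay_shift d ks)%N].

Definition jump (a : nat -> int) (i : nat) : Prop :=
  a i <= i%:Z /\ a i < a i.+1.

Definition first_jump (a : nat -> int) (i : nat) : Prop :=
  jump a i /\ forall k, (k < i)%N -> ~ jump a k.

Definition linear_form (K : fieldType) (n : nat) (v : 'I_n.+1 -> K) :
    {mpoly K[n.+1]} := \sum_i v i *: 'X_i.

Definition zariski_open (K : fieldType) (n : nat) (U : set ('I_n.+1 -> K)) : Prop :=
  exists S : set {mpoly K[n.+1]},
    forall v, U v <-> exists2 p, S p & p.@[v] != 0.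

(* "L is a general linear form" means that the coefficient vector of L lies in
   a nonempty Zariski open set, which may depend on the current ideal I and on
   the chosen form F. *)
Definition genericity_condition (K : fieldType) (n : nat)
    (U : set {mpoly K[n.+1]} -> {mpoly K[n.+1]} -> set ('I_n.+1 -> K)) : Prop :=
  forall I F, zariski_open (U I F) /\ U I F !=set0.

(* The ideal L I + (F), for an ideal I. *)
Definition double_link (K : fieldType) (n : nat) (I : set {mpoly K[n.+1]})
    (L F : {mpoly K[n.+1]}) : set {mpoly K[n.+1]} :=
  [set p | exists2 g, I g & exists r, p = L * g + r * F].

Definition algorithm_step (K : fieldType) (n : nat)
    (U : set {mpoly K[n.+1]} -> {mpoly K[n.+1]} -> set ('I_n.+1 -> K))
    (I : set {mpoly K[n.+1]}) (F : {mpoly K[n.+1]})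
    (J : set {mpoly K[n.+1]}) : Prop :=
  ~ O_sequence (hvector I) /\
  exists (i : nat) (v : 'I_n.+1 -> K),
    [/\ first_jump (hvector I) i, [/\ I F, F != 0 & F \is (i + 2).-homog],
        U I F v & J = double_link I (linear_form v) F].

(* [algorithm_run U I Fs J]: J is obtained from I by successive steps using
   the forms listed in Fs, in this order. *)
Inductive algorithm_run (K : fieldType) (n : nat)
    (U : set {mpoly K[n.+1]} -> {mpoly K[n.+1]} -> set ('I_n.+1 -> K)) :
    set {mpoly K[n.+1]} -> seq {mpoly K[n.+1]} -> set {mpoly K[n.+1]} -> Prop :=
| run_nil I : algorithm_run U I [::] I
| run_cons I F J Fs J' : algorithm_step U I F J -> algorithm_run U J Fs J' ->
    algorithm_run U I (F :: Fs) J'.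

Definition infinite_run (K : fieldType) (n : nat)
    (U : set {mpoly K[n.+1]} -> {mpoly K[n.+1]} -> set ('I_n.+1 -> K))
    (I : set {mpoly K[n.+1]}) : Prop :=
  exists (Is : nat -> set {mpoly K[n.+1]}) (Fs : nat -> {mpoly K[n.+1]}),
    Is 0%N = I /\ forall k, algorithm_step U (Is k) (Fs k) (Is k.+1).

(* Total degree; [msize] is one more than the degree of a nonzero polynomial. *)
Definition form_degree (K : fieldType) (n : nat) (F : {mpoly K[n.+1]}) : nat :=
  (msize F).-1.

(* Main.v *)
(** Write a = Delta^(n-1) h_(R/I).  If F in I has degree d and the linear form L does
    not divide F, then (L I + (F)) : L = I and L I + (F) + (L) = (L, F), so one step
    replaces a by b with b_j = a_(j-1) + 1 for j < d and b_j = a_(j-1) for j >= d.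
    With d = i + 2 for the first jump i of a, all jumps of b are beyond i (hence the
    degrees increase), and the total size of the upward jumps of a beyond the initial
    degree drops by one (hence the algorithm stops).

    That a has finite support is the only place where height(I) >= 2 enters.  If I
    contained no nonzero polynomial in some n of the variables, an ideal Q containing I
    and maximal among those with this property would be prime with R/Q of transcendence
    degree n, and a chain of two primes below Q would give n + 2 algebraically
    independent elements of R.  So the initial ideal of I contains a monomial in any n of
    the variables; Dickson's lemma and induction on the number of variables then show
    that Delta^(n-1) of its Hilbert function is eventually zero.

    When the algorithm stops, b is an O-sequence with b_(j+1) <= b_j as soon as b_j <= j.
    Then the monomials x_0^p x_1^q with q >= b_(p+q) (times anything) span an ideal IY
    with Delta^(n-1) h_(R/IY) = b, on which x_2, ..., x_n is a regular sequence.  Upper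
    bounds on dimension, depth and height follow from the same independence count, as a
    regular element or a strict inclusion of primes each raises by one the exponent k in
    the number N^k of independent elements of degree O(N). *)
Require Import Defs.
From mathcomp Require Import all_boot all_order all_algebra.
From mathcomp Require Import boolp classical_sets cardinality.
From mathcomp Require Import mpoly.
From mathcomp Require Import zify.

Set Implicit Arguments.
Unset Strict Implicit.
Unset Printing Implicit Defensive.

Import Order.TTheory GRing.Theory Num.Theory.

Local Open Scope classical_set_scope.
Local Open Scope ring_scope.

(** * Numerical sequences *)

(** The shape of the h-vector of an ideal of initial degree [s]: below [s] the values [j + 1] of the
    zero ideal, at [s] something smaller, and support below [N]. *)
Definition stair (a : nat -> int) (s N : nat) : Prop :=
  [/\ (0 < s)%N, forall j, (j < s)%N -> a j = j.+1%:Z, a s <= s%:Z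
    & forall j, (N <= j)%N -> a j = 0].

(** The h-vector after a step with a form of degree [d]: multiplication by [L] shifts [a], and the
    ideal [(L, F)] contributes 1 in every degree below [d]. *)
Definition step_seq (a : nat -> int) (d : nat) (j : nat) : int :=
  (if j is j'.+1 then a j' else 0) + (j < d)%N%:Z.

(** The termination measure: the total rise of [a] from the initial degree on, with descents cut off
    at 0. *)
Definition excess (a : nat -> int) (s N : nat) : nat :=
  (\sum_(s <= k < N) `|Num.max (a k.+1 - a k)%R 0%R|)%N.

Lemma stair_jump_ge a s N i : stair a s N -> jump a i -> (s <= i)%N.
Proof.
case=> _ hlt _ _ [hi _]; rewrite leqNgt; apply/negP => /hlt e.
by move: hi; rewrite e; lia.
Qed.

Lemma stair_jump_lt a s N i : stair a s N -> jump a i -> (i < N)%N.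
Proof.
case=> _ _ _ h0 [_ hi]; rewrite ltnNge; apply/negP => le.
by move: hi; rewrite !h0 ?ltxx //; lia.
Qed.

Lemma stair_step a s N i : stair a s N -> first_jump a i ->
  stair (step_seq a i.+2) s.+1 N.+1.
Proof.
move=> st [ji _]; have si := stair_jump_ge st ji; have iN := stair_jump_lt st ji.
case: st => s0 hlt hs h0; split=> //.
- case=> [|j] jlt; rewrite /step_seq; first by [].
  rewrite hlt //; have -> : (j.+1 < i.+2)%N by lia.
  lia.
- rewrite /step_seq; have -> : (s.+1 < i.+2)%N by lia.
  lia.
- case=> [|j] jN //; rewrite /step_seq h0 //.
  by have -> : (j.+1 < i.+2)%N = false by lia.
Qed.

(** For [k.+1 <= i] the values at [k.+1] and [k.+2] are both raised by 1, so a jump of the new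
    sequence at [k.+1] would be a jump of [a] at [k < i]. *)
Lemma first_jump_step a s N i k : stair a s N -> first_jump a i ->
  jump (step_seq a i.+2) k -> (i < k)%N.
Proof.
move=> st [ji hi] [k1 k2]; rewrite ltnNge; apply/negP => ki.
case: k k1 k2 ki => [|k]; rewrite /step_seq; first by lia.
have [-> ->] : (k.+2 < i.+2)%N = (k < i)%N /\ (k.+1 < i.+2)%N = (k <= i)%N by lia.
move=> k1 k2 ki; apply: (hi k) => //; rewrite /jump.
by move: k1 k2; rewrite ki ltnW //=; lia.
Qed.

Lemma excess_step a s N i : stair a s N -> first_jump a i ->
  (excess (step_seq a i.+2) s.+1 N.+1 < excess a s N)%N.
Proof.
move=> st [ji _]; have si := stair_jump_ge st ji; have iN := stair_jump_lt st ji.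
(* After the shift all increments are unchanged except the positive one at [i], which drops by 1;
   this indicator sum makes the strict inequality termwise. *)
have e1 : (\sum_(s <= k < N) (k == i) = 1)%N.
  rewrite (bigD1_seq i) ?iota_uniq ?mem_index_iota ?si //= eqxx big1 //.
  by move=> k /negPf ->.
rewrite /excess big_add1 /= -addn1 -[X in (_ + X)%N]e1 -big_split /=.
rewrite leq_sum // => k _; rewrite /step_seq.
case: ji => _ ji.
case: (ltngtP k i) => ki.
- have [-> ->] : (k.+2 < i.+2)%N /\ (k.+1 < i.+2)%N by lia.
  lia.
- have [-> ->] : (k.+2 < i.+2)%N = false /\ (k.+1 < i.+2)%N = false by lia.
  lia.
- rewrite ki ltnn ltnSn; lia.
Qed.

Lemma stair_first_jump a : (exists i, jump a i) -> exists i, first_jump a i.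
Proof.
move=> [i0 h0].
pose P i := (a i <= i%:Z) && (a i < a i.+1).
have PP i : P i <-> jump a i by rewrite /jump; split=> [/andP|/andP].
have [] := @ex_minnP P; first by exists i0; apply/PP.
move=> i /PP ji hi; exists i; split=> // k ki /PP /hi; lia.
Qed.

(** When [a <= d] all binomials of the representation are [C(d - i, d - i) = 1]: a larger entry
    anywhere forces the top entry to be at least [d + 1], and [C(d + 1, d) = d + 1] already exceeds
    [a]. *)
Lemma macaulay_rep_le d a ks : macaulay_rep d a ks -> (a <= d)%N ->
  macaulay_shift d ks = a.
Proof.
move=> [srt sz lb ->] le; rewrite /macaulay_shift.
have small i : (i < size ks)%N -> nth 0%N ks i = (d - i)%N.
  move=> iks; apply/eqP; rewrite eqn_leq lb // andbT leqNgt; apply/negP => gt.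
  have k0 : (d < nth 0 ks 0)%N.
    case: i iks gt => [|i] iks gt; first by rewrite subn0 in gt.
    (* By strict decrease each place towards the front gains at least 1, which carries the excess at
       [i.+1] to the top entry. *)
    have h : forall j, (j <= i.+1)%N -> (nth 0 ks i.+1 + (i.+1 - j) <= nth 0 ks j)%N.
      move=> j; move: {2}(i.+1 - j)%N (erefl (i.+1 - j)%N) => k; elim: k j => [|k IH] j ek jle.
        by rewrite (_ : j = i.+1) ?subnn ?addn0 //; lia.
      have IHj := IH j.+1 ltac:(lia) ltac:(lia).
      have : (nth 0 ks j.+1 < nth 0 ks j)%N.
        have tr : transitive gtn by move=> x y z /= h1 h2; lia.
        by apply: (sorted_ltn_nth tr 0%N srt); rewrite ?inE //; lia.
      lia.
    have := h 0%N; lia.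
  have ks0 : (0 < size ks)%N by lia.
  have : ('C(nth 0 ks (Ordinal ks0), d - Ordinal ks0) <= d)%N.
    apply: leq_trans le; rewrite (bigD1 (Ordinal ks0)) //=; exact: leq_addr.
  rewrite /= subn0 => h2.
  have : ('C(d.+1, d) <= 'C(nth 0 ks 0, d))%N by exact: leq_bin2l.
  rewrite binSn; lia.
apply: eq_bigr => i _; rewrite small //.
by rewrite !binn.
Qed.

(** The form in which Macaulay's bound is used for the final ideal. At [d = 0] the premise fails
    because [b 0 = 1]. *)
Lemma O_sequence_noninc a : O_sequence a -> exists b : nat -> nat,
  [/\ forall j, a j = (b j)%:Z, b 0%N = 1%N
    & forall d, (b d <= d)%N -> (b d.+1 <= b d)%N].
Proof.
move=> [b [ab b0 hb]]; exists b; split=> // -[|d]; first by rewrite b0.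
by move=> le; have [//|ks hks] := hb d.+1; rewrite (macaulay_rep_le hks).
Qed.

Lemma nojump_noninc a s N : stair a s N -> (forall i, ~ jump a i) ->
  forall j, (s <= j)%N -> a j.+1 <= a j /\ a j <= j%:Z.
Proof.
move=> [_ _ hs _] nj j sj.
have h : a j <= j%:Z -> a j.+1 <= a j.
  by move=> aj; rewrite leNgt; apply/negP => lt; apply: (nj j).
suff aj : a j <= j%:Z by split; [exact: h|].
rewrite -(subnKC sj); elim: (j - s)%N => [|k IH]; first by rewrite addn0.
have : a (s + k).+1 <= a (s + k)%N.
  by rewrite leNgt; apply/negP => lt; apply: (nj (s + k)%N).
rewrite addnS; lia.
Qed.

Lemma nojump_ge0 a s N : stair a s N -> (forall i, ~ jump a i) ->
  forall j, 0 <= a j.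
Proof.
move=> st nj j; have [js|sj] := ltnP j s.
  by case: st => _ h _ _; rewrite h.
have h k : a (j + k)%N <= a j.
  elim: k => [|k IH]; first by rewrite addn0.
  have := (@nojump_noninc _ _ _ st nj (j + k)%N); rewrite addnS; lia.
have := h N; case: st => _ _ _ -> //; lia.
Qed.

Lemma nojump_O_sequence a s N : stair a s N -> (forall i, ~ jump a i) ->
  O_sequence a.
Proof.
move=> st nj; exists (fun j => `|a j|%N); split.
- by move=> j; rewrite gez0_abs // (nojump_ge0 st nj).
- by case: st => s0 h _ _; rewrite h.
move=> d d0; have [ds|sd] := ltnP d s.
  (* Below [s] the value [d + 1] is the single binomial [C(d + 1, d)], and its shift [d + 2] bounds
     the next value. *)
  exists [:: d.+1]; rewrite /macaulay_rep /macaulay_shift /= !big_ord1 /= !subn0.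
    split=> //.
      by move=> [|i] //= _; lia.
    by case: st => _ h _ _; rewrite h // binSn.
  rewrite binSn; have [ds'|] := ltnP d.+1 s; first by case: st => _ h _ _; rewrite h.
  have := nojump_ge0 st nj s; case: st => _ _ hs _ ? sd; have -> : d.+1 = s by lia.
  lia.
have [h1 h2] := nojump_noninc st nj sd.
have p1 := nojump_ge0 st nj d; have p2 := nojump_ge0 st nj d.+1.
(* From [s] on, [a d <= d] is a sum of [a d] binomials [C(d - i, d - i)], whose shift is again
   [a d]. *)
pose ks := [seq (d - i)%N | i <- iota 0 `|a d|].
have szks : size ks = `|a d|%N by rewrite size_map size_iota.
have nks i : (i < `|a d|)%N -> nth 0%N ks i = (d - i)%N.
  by move=> lt; rewrite (nth_map 0%N) ?size_iota // nth_iota.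
exists ks; rewrite /macaulay_rep /macaulay_shift szks.
  split.
  - apply/(sortedP 0%N) => i; rewrite szks => lt.
    by rewrite !nks //=; lia.
  - lia.
  - by move=> i lt; rewrite nks.
  - rewrite (eq_bigr (fun=> 1%N)); first by rewrite sum1_card card_ord.
    by move=> i _; rewrite nks // binn.
rewrite (eq_bigr (fun=> 1%N)); first by rewrite sum1_card card_ord; lia.
by move=> i _; rewrite nks // binn.
Qed.

Lemma noninc_from (b : nat -> nat) j j' :
  (forall j, (b j <= j)%N -> (b j.+1 <= b j)%N) ->
  (b j <= j)%N -> (j <= j')%N -> (b j' <= b j)%N.
Proof.
move=> bni bj; elim: j' => [|j' IH]; first by rewrite leqn0 => /eqP ->.
rewrite leq_eqVlt => /predU1P[<-//|jj']; have h := IH jj'.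
by apply: leq_trans h; apply: bni; lia.
Qed.

(** * Differences and exact sequences *)

Definition shift_seq (d : nat) (h : nat -> int) (j : nat) : int :=
  if (j < d)%N then 0 else h (j - d)%N.

Definition eventually_zero (h : nat -> int) : Prop :=
  exists N, forall j, (N <= j)%N -> h j = 0.

Lemma diffE h j : diff h j = h j - (if j is j'.+1 then h j' else 0).
Proof. by []. Qed.

Lemma diffD f g : diff (f \+ g) = diff f \+ diff g.
Proof. by apply: funext => -[|j]; rewrite /diff /=; lia. Qed.

Lemma iter_diffD k f g : iter k diff (f \+ g) = iter k diff f \+ iter k diff g.
Proof. by elim: k => //= k ->; rewrite diffD. Qed.

Lemma diff_shift d f : diff (shift_seq d f) = shift_seq d (diff f).
Proof.
apply: funext => -[|j]; rewrite /diff /shift_seq /=.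
  by rewrite sub0n subr0 subr0.
have [jd|] := ltnP j.+1 d; first by rewrite ltnW // subrr.
rewrite leq_eqVlt => /predU1P[->|dj]; first by rewrite ltnSn subnn.
by rewrite ltnNge -ltnS dj /= subSn.
Qed.

Lemma iter_diff_shift k d f :
  iter k diff (shift_seq d f) = shift_seq d (iter k diff f).
Proof. by elim: k => //= k ->; rewrite diff_shift. Qed.

Lemma diff_inj : injective diff.
Proof.
move=> f g fg; apply: funext; elim=> [|j IH].
  by have := congr1 (@^~ 0%N) fg; rewrite /diff !subr0.
by have := congr1 (@^~ j.+1) fg; rewrite /diff IH => /addIr.
Qed.

Lemma iter_diff_inj k : injective (iter k diff).
Proof. by elim: k => [|k IH] f g //= /diff_inj /IH. Qed.

Lemma iter_diff_local k f g m : (forall j, (j <= m)%N -> f j = g j) ->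
  iter k diff f m = iter k diff g m.
Proof.
elim: k m => [|k IH] m fg; first exact: fg.
rewrite /= /diff IH //; case: m fg => [|m] fg //.
by rewrite (IH m) // => j jm; apply: fg; lia.
Qed.

(** Each difference subtracts only earlier values, on which [f] and [g] agree. *)
Lemma iter_diff_delta k f g m : (forall j, (j < m)%N -> f j = g j) ->
  iter k diff f m - iter k diff g m = f m - g m.
Proof.
elim: k m => [|k IH] m fg //; rewrite !iterS !diffE.
have -> : (if m is j'.+1 then iter k diff f j' else 0) =
          (if m is j'.+1 then iter k diff g j' else 0).
  case: m fg => // m fg; apply: iter_diff_local => j jm; exact: fg.
have := IH m fg; set u := (if m is _.+1 then _ else _); lia.
Qed.

Lemma eventually_zeroD f g :
  eventually_zero f -> eventually_zero g -> eventually_zero (f \+ g).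
Proof.
move=> [N hN] [M hM]; exists (maxn N M) => j jl /=; rewrite hN ?hM //; lia.
Qed.

Lemma eventually_zero_shift d f : eventually_zero f -> eventually_zero (shift_seq d f).
Proof.
move=> [N hN]; exists (N + d)%N => j jl; rewrite /shift_seq.
by have -> : (j < d)%N = false by [lia]; rewrite hN //; lia.
Qed.

Lemma eventually_zero_diff k f : eventually_zero f -> eventually_zero (iter k diff f).
Proof.
elim: k => // k IH /IH [N hN]; exists N.+1 => -[|j] // jl.
by rewrite /= /diff !hN //; lia.
Qed.

(** * Linear algebra modulo an ideal, and graded exact sequences *)

Section Ideals.
Variables (K : fieldType) (n : nat).
Local Notation R := {mpoly K[n.+1]}.
Implicit Types (I J Q : set R).

Section IdealTheory.
Variables (I : set R) (hI : is_ideal I).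

Lemma ideal0 : I 0. Proof. by case: hI. Qed.

Lemma idealD f g : I f -> I g -> I (f + g).
Proof. by case: hI => _ h _; exact: h. Qed.

Lemma idealM r f : I f -> I (r * f).
Proof. by case: hI => _ _ h; exact: h. Qed.

Lemma idealMr r f : I f -> I (f * r).
Proof. by rewrite mulrC; exact: idealM. Qed.

Lemma idealZ (c : K) f : I f -> I (c *: f).
Proof. by rewrite -mul_mpolyC; exact: idealM. Qed.

Lemma idealN f : I f -> I (- f).
Proof. by rewrite -mulN1r; exact: idealM. Qed.

Lemma idealB f g : I f -> I g -> I (f - g).
Proof. by move=> hf hg; apply: idealD => //; exact: idealN. Qed.

Lemma ideal_sum (T : Type) (r : seq T) (P : pred T) (F : T -> R) :
  (forall t, P t -> I (F t)) -> I (\sum_(t <- r | P t) F t).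
Proof. by move=> h; elim/big_ind: _ => //; [exact: ideal0 | exact: idealD]. Qed.

End IdealTheory.

Definition indep_mod I (T : finType) (e : T -> R) : Prop :=
  forall c : T -> K, I (\sum_t c t *: e t) -> forall t, c t = 0.

(** A coefficient matrix with more rows than columns has a nonzero left kernel vector, which would
    be a relation modulo [I] among the [e t]. *)
Lemma indep_le_span I (T W : finType) (e : T -> R) (g : W -> R) :
  is_ideal I -> indep_mod I e ->
  (forall t, exists c : W -> K, I (e t - \sum_w c w *: g w)) -> (#|T| <= #|W|)%N.
Proof.
move=> hI ind /choice[c hc]; rewrite leqNgt; apply/negP => lt.
pose A : 'M[K]_(#|T|, #|W|) := \matrix_(i, j) c (enum_val i) (enum_val j).
have : kermx A != 0.
  rewrite -mxrank_eq0 mxrank_ker subn_eq0 -ltnNge.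
  exact: leq_ltn_trans (rank_leq_col A) lt.
case/rowV0Pn => u /sub_kermxP uA; apply/negP; rewrite negbK; apply/eqP/rowP => i.
pose d t := u 0 (enum_rank t).
rewrite mxE -[i]enum_valK; apply: (ind d).
have -> : \sum_t d t *: e t =
    \sum_t d t *: (e t - \sum_w c t w *: g w) +
    \sum_w (\sum_t d t * c t w) *: g w.
  have -> : \sum_w (\sum_t d t * c t w) *: g w =
      \sum_t d t *: (\sum_w c t w *: g w).
    rewrite (eq_bigr (fun w => \sum_t (d t * c t w) *: g w)); last first.
      by move=> w _; rewrite scaler_suml.
    rewrite exchange_big; apply: eq_bigr => t _; rewrite scaler_sumr.
    by apply: eq_bigr => w _; rewrite scalerA.
  by rewrite -big_split /=; apply: eq_bigr => t _; rewrite -scalerDr subrK.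
apply: idealD => //.
  by apply: (ideal_sum hI) => t _; apply: (idealZ hI).
rewrite big1; first exact: ideal0.
move=> w _; have /rowP/(_ (enum_rank w)) := uA; rewrite !mxE => h.
suff -> : \sum_t d t * c t w = 0 by rewrite scale0r.
rewrite -[RHS]h (reindex (@enum_val T T)) /=; last exact/onW_bij/enum_val_bij.
by apply: eq_bigr => k _; rewrite /A mxE /d enum_valK enum_rankK.
Qed.

Lemma graded_quotient_dim_uniq I j d1 d2 : is_ideal I ->
  graded_quotient_dim I j d1 -> graded_quotient_dim I j d2 -> d1 = d2.
Proof.
suff le e1 e2 : is_ideal I -> graded_quotient_dim I j e1 ->
    graded_quotient_dim I j e2 -> (e1 <= e2)%N.
  by move=> hI h1 h2; apply/eqP; rewrite eqn_leq !le.
move=> hI [b1 [hom1 ind1 _]] [b2 [_ _ sp2]].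
rewrite -[e1]card_ord -[e2]card_ord; apply: (indep_le_span hI ind1) => t.
exact: sp2.
Qed.

Lemma hilbertE I j d : is_ideal I -> graded_quotient_dim I j d -> hilbert I j = d.
Proof.
move=> hI h; rewrite /hilbert; case: xgetP => [e _ he|/(_ d) //].
exact: (graded_quotient_dim_uniq hI he h).
Qed.

Lemma mcoeff_pihomog d (f : R) m :
  (pihomog mdeg d f)@_m = if mdeg m == d then f@_m else 0.
Proof.
rewrite (pihomogwE _ _ (leqnn (msize f))) raddf_sum /=.
under eq_bigr => k _ do rewrite mcoeffZ mcoeffX.
have [ltm|gem] := ltnP (mdeg m) (msize f); last first.
  rewrite (memN_msupp_eq0 (msize_mdeg_ge gem)) if_same big1 // => k _.
  case: eqP => [km|_]; last by rewrite mulr0.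
  by move: gem (bmdeg k); rewrite -km => /leq_ltn_trans h /h; rewrite ltnn.
rewrite big_mkcond (bigD1 (BMultinom ltm)) //= eqxx mulr1 [X in _ + X]big1 ?addr0 //.
move=> k; rewrite -val_eqE /= => /negPf ->; rewrite mulr0.
by rewrite if_same.
Qed.

Lemma pihomogM d e (L q : R) : L \is d.-homog ->
  pihomog mdeg (e + d) (q * L) = pihomog mdeg e q * L.
Proof.
move=> hL; rewrite [in LHS](@pihomog_partitionE _ _ mdeg (msize q + e.+1) q) ?leq_addr //.
rewrite mulr_suml raddf_sum /=.
have h (k : nat) : k != e -> pihomog mdeg (e + d) (pihomog mdeg k q * L) = 0.
  move=> ke; apply: (@pihomog_ne0 _ _ _ (k + d)%N); first by rewrite eqn_add2r.
  by apply: dhomogM => //; exact: pihomogP.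
have lt : (e < msize q + e.+1)%N by lia.
rewrite (bigD1 (Ordinal lt)) //= big1 ?addr0.
  by rewrite pihomog_dE //; apply: dhomogM => //; exact: pihomogP.
by move=> k; rewrite -val_eqE /= => /h.
Qed.

Lemma pihomogM_lt d e (L q : R) : L \is d.-homog -> (e < d)%N ->
  pihomog mdeg e (q * L) = 0.
Proof.
move=> hL ed; rewrite [in LHS](@pihomog_partitionE _ _ mdeg (msize q) q) //.
rewrite mulr_suml raddf_sum /= big1 // => k _.
apply: (@pihomog_ne0 _ _ _ (k + d)%N); first by lia.
by apply: dhomogM => //; exact: pihomogP.
Qed.

Definition colon_mod I J (L : R) : Prop := forall g, J (L * g) <-> I g.

Definition adjoin_mod J (L : R) Q : Prop := forall f, Q f <-> exists q, J (f - q * L).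

(* The graded exact sequence 0 -> (R/I)(-d) --L--> R/J -> R/Q -> 0, where I = J : L
   and Q = J + (L). *)
Lemma graded_quotient_dim_exact I J Q L d j a b :
  is_homogeneous_ideal J -> L \is d.-homog -> colon_mod I J L -> adjoin_mod J L Q ->
  graded_quotient_dim I j a -> graded_quotient_dim Q (j + d) b ->
  graded_quotient_dim J (j + d) (a + b).
Proof.
move=> [hJ gJ] hL hIJ hQ [e [he ie se]] [t [ht it st]].
have JQ f : J f -> Q f by move=> Jf; apply/hQ; exists 0; rewrite mul0r subr0.
pose u (k : 'I_(a + b)) : R :=
  match split k with inl i => L * e i | inr i => t i end.
have sumu c : \sum_k c k *: u k =
    L * (\sum_i c (lshift b i) *: e i) + \sum_i c (rshift a i) *: t i.
  rewrite big_split_ord /= mulr_sumr; congr (_ + _); apply: eq_bigr => i _.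
    by rewrite /u (unsplitK (inl i)) scalerAr.
  by rewrite /u (unsplitK (inr i)).
exists u; split.
- move=> k; rewrite /u; case: splitP => i _ //.
  by rewrite mulrC; apply: dhomogM.
- move=> c; rewrite sumu => Jc.
  have cr : forall i, c (rshift a i) = 0.
    apply: it; apply/hQ; exists (- (\sum_i c (lshift b i) *: e i)).
    by rewrite mulNr opprK addrC mulrC.
  have cl : forall i, c (lshift b i) = 0.
    apply: ie; apply/hIJ; move: Jc; rewrite [X in _ + X]big1 ?addr0 //.
    by move=> i _; rewrite cr scale0r.
  by move=> k; rewrite -(splitK k); case: (split k).
- move=> f hf; have [c2 /hQ[q Jq]] := st f hf.
  set g := f - _ in Jq.
  have hg : g \is (j + d).-homog.
    by rewrite rpredB // rpred_sum // => i _; rewrite rpredZ.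
  (* The cofactor [q] need not be a form; taking the component of degree [j + d] replaces it by its
     part of degree [j]. *)
  have Jq' : J (g - pihomog mdeg j q * L).
    by rewrite -(pihomogM _ _ hL) -(pihomog_dE hg) -pihomogB; apply: gJ.
  have [c1 hc1] := se _ (pihomogP mdeg j q).
  exists (fun k => match split k with inl i => c1 i | inr i => c2 i end).
  have -> : \sum_k (match split k with inl i => c1 i | inr i => c2 i end) *: u k =
      L * (\sum_i c1 i *: e i) + \sum_i c2 i *: t i.
    rewrite sumu; congr (_ * _ + _); apply: eq_bigr => i _.
      by rewrite (unsplitK (inl i)).
    by rewrite (unsplitK (inr i)).
  move/hIJ: hc1 => hc1; have := idealD hJ Jq' hc1; rewrite /g mulrBr.
  congr (J _); rewrite [_ * L]mulrC -!addrA; congr (_ + _).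
  by rewrite addKr opprD addrC.
Qed.

Lemma graded_quotient_dim_exact_lt J Q L d j b :
  is_homogeneous_ideal J -> L \is d.-homog -> adjoin_mod J L Q -> (j < d)%N ->
  graded_quotient_dim Q j b -> graded_quotient_dim J j b.
Proof.
move=> [hJ gJ] hL hQ jd [t [ht it st]].
have JQ f : J f -> Q f by move=> Jf; apply/hQ; exists 0; rewrite mul0r subr0.
exists t; split=> //; first by move=> c /JQ; exact: it.
move=> f hf; have [c /hQ[q Jq]] := st f hf; exists c.
have hg : f - \sum_i c i *: t i \is j.-homog.
  by rewrite rpredB // rpred_sum // => i _; rewrite rpredZ.
by have := gJ _ Jq j; rewrite pihomogB (pihomogM_lt _ hL jd) subr0 pihomog_dE.
Qed.

End Ideals.

(** * Initial ideals *)

Section Monomial.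
Variables (K : fieldType) (n : nat).
Local Notation R := {mpoly K[n.+1]}.
Local Notation mnm := 'X_{1..n.+1}.
Implicit Types (I J Q : set R) (S : set mnm).

Definition mono_ideal S : set R := [set f | forall m, f@_m != 0 -> S m].

Definition upset S : Prop := forall m m' : mnm, S m -> S (m + m')%MM.

Lemma mono_ideal_is_ideal S : upset S -> is_ideal (mono_ideal S).
Proof.
move=> up; split.
- by move=> m; rewrite mcoeff0 eqxx.
- move=> f g hf hg m; rewrite mcoeffD.
  have [->|/hf//] := eqVneq f@_m 0; rewrite add0r; exact: hg.
- move=> r f hf m; rewrite -mcoeff_msupp => /msuppM_le /allpairsP[[k1 k2] /= [_ h2 ->]].
  by rewrite addmC; apply/up/hf; rewrite -mcoeff_msupp.
Qed.

Lemma mono_ideal_homogeneous S : upset S -> is_homogeneous_ideal (mono_ideal S).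
Proof.
move=> up; split; first exact: mono_ideal_is_ideal.
move=> f hf d m; rewrite mcoeff_pihomog; case: ifP => _; last by rewrite eqxx.
exact: hf.
Qed.

Lemma mcoeffX_neq0 (m m' : mnm) : (('X_[m] : R)@_m' != 0) = (m == m').
Proof. by rewrite mcoeffX; case: (m == m'); rewrite ?oner_eq0 ?eqxx. Qed.

Lemma mono_idealX S m : mono_ideal S 'X_[m] <-> S m.
Proof.
split=> [/(_ m)|Sm m']; rewrite mcoeffX_neq0; first by apply.
by move/eqP <-.
Qed.

Lemma mono_ideal_sub S I : is_ideal I -> (forall m, S m -> I 'X_[m]) ->
  mono_ideal S `<=` I.
Proof.
move=> hI h f hf; rewrite (mpolyE f) big_seq; apply: (ideal_sum hI) => m.
by rewrite mcoeff_msupp => /hf /h; exact: idealZ.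
Qed.

Lemma mono_ideal_adjoin S i : upset S ->
  adjoin_mod (mono_ideal S) 'X_i (mono_ideal (S `|` [set m | m i != 0%N])).
Proof.
move=> up f; split=> [hf|[q hq] m fm].
  exists (\sum_(m <- msupp f | m i != 0%N) f@_m *: 'X_[m - U_(i)]).
  rewrite [X in X - _]mpolyE (bigID (fun m : mnm => m i != 0%N)) /= mulr_suml.
  set s1 := (X in X + _ - _); set s2 := (X in _ + X - _).
  set s3 := (X in _ - X).
  have -> : s3 = s1.
    apply: eq_bigr => m mi; rewrite -scalerAl -mpolyXD submK //.
    by rewrite lep1mP.
  rewrite [s1 + _]addrC addrK /s2 big_seq_cond.
  apply: (ideal_sum (mono_ideal_is_ideal up)) => m /andP[].
  rewrite mcoeff_msupp => /hf fm mi.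
  apply: (idealZ (mono_ideal_is_ideal up)); apply/mono_idealX.
  by case: fm => //= mi0; rewrite mi0 in mi.
have [e|/hq] := eqVneq (f - q * 'X_i)@_m 0; last by left.
right; move: fm; rewrite -(subrK (q * 'X_i) f) mcoeffD e add0r.
rewrite -mcoeff_msupp (perm_mem (msuppMX _ _)) => /mapP[k _ ->].
by rewrite /= mnmDE mnm1E eqxx.
Qed.

Lemma mono_ideal_colon S i :
  colon_mod (mono_ideal [set m | S (U_(i) + m)%MM]) (mono_ideal S) 'X_i.
Proof.
move=> g; rewrite mulrC; split=> h m.
  by move=> gm; apply: h; rewrite mcoeffMX.
rewrite -mcoeff_msupp (perm_mem (msuppMX _ _)) => /mapP[k kg ->].
by apply: h; rewrite -mcoeff_msupp.
Qed.

(** The exponents in the initial ideal of [I], realised by forms so that they can be counted degree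
    by degree. *)
Definition lead_set I : set mnm := [set m | exists f, [/\ I f, f \is (mdeg m).-homog,
  f@_m != 0 & forall m', f@_m' != 0 -> (m' <= m)%O]].

Lemma lead_set_upset I : is_ideal I -> upset (lead_set I).
Proof.
move=> hI m m' [f [If hf fm fle]]; exists (f * 'X_[m']); split.
- exact: (idealMr hI).
- by rewrite mdegD; apply: dhomogM => //; rewrite dhomogX.
- by rewrite addmC mcoeffMX.
- move=> k; rewrite -mcoeff_msupp (perm_mem (msuppMX _ _)) => /mapP[k' k'g ->].
  by rewrite [(m + _)%MM]addmC lemc_add2r fle // -mcoeff_msupp.
Qed.

Lemma lead_set_mono S : lead_set (mono_ideal S) = S.
Proof.
apply/seteqP; split=> [m [f [h _ /h//]]|m Sm].
exists 'X_[m]; split; first exact/mono_idealX.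
- by rewrite dhomogX.
- by rewrite mcoeffX_neq0.
- by move=> m'; rewrite mcoeffX_neq0 => /eqP ->.
Qed.

Definition std_monomials S j : {set 'X_{1..n.+1 < j.+1}} :=
  [set k : 'X_{1..n.+1 < j.+1} | (mdeg k == j) && `[< ~ S k >] ]%SET.

(** Macaulay's basis theorem: the basis consists of the standard monomials, and forms are reduced to
    it by induction on the leading monomial. *)
Lemma graded_quotient_dim_lead I j : is_ideal I ->
  graded_quotient_dim I j #|std_monomials (lead_set I) j|.
Proof.
move=> hI; set S := lead_set I; set T := std_monomials S j.
pose e (i : 'I_#|T|) : R := 'X_[enum_val i].
have Tin (i : 'I_#|T|) : mdeg (enum_val i) = j /\ ~ S (enum_val i).
  by have := enum_valP i; rewrite inE => /andP[/eqP ? /asboolP].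
have coef (c : 'I_#|T| -> K) (i : 'I_#|T|) : (\sum_i c i *: e i)@_(enum_val i) = c i.
  rewrite raddf_sum /= (bigD1 i) //= big1 ?addr0.
    by rewrite mcoeffZ mcoeffX eqxx mulr1.
  move=> k ki; rewrite mcoeffZ mcoeffX; case: eqP => [/val_inj/enum_val_inj eki|].
    by rewrite eki eqxx in ki.
  by rewrite mulr0.
have homT (c : 'I_#|T| -> K) : \sum_i c i *: e i \is j.-homog.
  by rewrite rpred_sum // => i _; rewrite rpredZ // dhomogX; apply/eqP; exact: (Tin i).1.
have suppT (c : 'I_#|T| -> K) m : (\sum_i c i *: e i)@_m != 0 -> exists i : 'I_#|T|, m = enum_val i.
  rewrite -mcoeff_msupp => /msupp_sum_le /flattenP[s /mapP[i _ ->]].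
  by move/msuppZ_le; rewrite msuppX inE => /eqP ->; exists i.
exists e; split.
- by move=> i; rewrite dhomogX; apply/eqP; exact: (Tin i).1.
(* A nonzero combination of standard monomials lying in [I] would have a leading monomial both
   standard and in the initial ideal. *)
- move=> c Ic i; set g := \sum_i _ in Ic.
  have [g0|g0] := eqVneq g 0; first by rewrite -[LHS]coef -/g g0 mcoeff0.
  have lg := mlead_supp g0; rewrite mcoeff_msupp in lg.
  have [k ek] := suppT _ _ lg; have [dk []] := Tin k; rewrite -ek.
  exists g; split=> //; first by rewrite ek dk; exact: homT.
  by move=> m' gm'; apply: msupp_le_mlead; rewrite mcoeff_msupp.
have zero : exists c : 'I_#|T| -> K, I (0 - \sum_i c i *: e i).
  exists (fun=> 0); rewrite big1 ?subr0; first exact: ideal0.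
  by move=> i _; rewrite scale0r.
suff main m f : f \is j.-homog -> f != 0 -> mlead f = m ->
    exists c : 'I_#|T| -> K, I (f - \sum_i c i *: e i).
  by move=> f hf; have [->//|f0] := eqVneq f 0; apply: main hf f0 erefl.
elim/(well_founded_ind (@ltom_wf n.+1)): m f => m IH f hf f0 fm.
have fmc : f@_m != 0 by rewrite -fm mleadc_eq0.
have dm : mdeg m = j.
  by apply: (dhomog_mf hf); rewrite mcoeff_msupp.
(* Cancelling the leading term of [f] against [h] lowers the leading monomial. Below, [h] is an
   element of [I] if [m] is in [S], and the monomial [m] itself otherwise. *)
have red h : h \is j.-homog -> h@_m != 0 -> (forall m', h@_m' != 0 -> (m' <= m)%O) ->
    exists c : 'I_#|T| -> K, I (f - (f@_m / h@_m) *: h - \sum_i c i *: e i).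
  move=> hh hm hle; set f' := f - _.
  have [->//|f'0] := eqVneq f' 0; apply: (IH (mlead f')) => //; last first.
    by rewrite rpredB // rpredZ.
  have := f'0; rewrite -mleadc_eq0; move: (mlead f') => k; rewrite lt_neqAle => h'.
  apply/andP; split.
    apply: contraNneq h' => ->; rewrite mcoeffB mcoeffZ divfK ?subrr //.
  have [fk|fk] := eqVneq f@_k 0; last first.
    by rewrite -fm msupp_le_mlead // mcoeff_msupp.
  apply: hle; apply: contraNneq h' => hk.
  by rewrite mcoeffB mcoeffZ fk hk mulr0 subrr.
have [Sm|Sm] := pselect (S m).
  have [h [Ih hh hm hle]] := Sm; rewrite dm in hh.
  have [c hc] := red h hh hm hle; exists c.
  by rewrite -(addrNK ((f@_m / h@_m) *: h) f) addrAC; apply: (idealD hI) => //; exact: idealZ.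
have [||m'|c hc] := red 'X_[m].
- by rewrite dhomogX; apply/eqP.
- by rewrite mcoeffX_neq0.
- by rewrite mcoeffX_neq0 => /eqP ->.
have mlt : (mdeg m < j.+1)%N by rewrite dm.
have mT : BMultinom mlt \in T by rewrite inE /= dm eqxx; apply/asboolP.
exists (fun i => c i + (if i == enum_rank_in mT (BMultinom mlt) then f@_m else 0)).
move: hc; rewrite mcoeffX eqxx divr1 -addrA -opprD; congr (I (_ - _)).
under [RHS]eq_bigr => i _ do rewrite scalerDl.
rewrite big_split /= addrC; congr (_ + _).
rewrite (bigD1 (enum_rank_in mT (BMultinom mlt))) //= eqxx big1 ?addr0.
  by rewrite /e enum_rankK_in.
by move=> i /negPf ->; rewrite scale0r.
Qed.

Lemma hilbertP I j : is_ideal I -> graded_quotient_dim I j (hilbert I j).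
Proof.
by move=> hI; have h := graded_quotient_dim_lead j hI; rewrite (hilbertE hI h).
Qed.

Lemma hilbert_lead I : is_ideal I -> hilbert I = hilbert (mono_ideal (lead_set I)).
Proof.
move=> hI; apply: funext => j; have up := lead_set_upset hI.
rewrite (hilbertE hI (graded_quotient_dim_lead j hI)).
have hM := mono_ideal_is_ideal up.
by rewrite (hilbertE hM (graded_quotient_dim_lead j hM)) lead_set_mono.
Qed.

Definition hilbZ I : nat -> int := fun j => (hilbert I j)%:Z.

Lemma hilbZ_exact I J Q L d :
  is_ideal I -> is_homogeneous_ideal J -> is_ideal Q -> L \is d.-homog ->
  colon_mod I J L -> adjoin_mod J L Q -> hilbZ J = shift_seq d (hilbZ I) \+ hilbZ Q.
Proof.
move=> hI hJ hQ hL hc ha; apply: funext => j; rewrite /hilbZ /shift_seq /=.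
have [jd|dj] := ltnP j d.
  rewrite add0r (hilbertE hJ.1 (graded_quotient_dim_exact_lt hJ hL ha jd (hilbertP j hQ))).
  by [].
have := graded_quotient_dim_exact hJ hL hc ha (hilbertP (j - d) hI) (hilbertP (j - d + d) hQ).
by rewrite subnK // => /(hilbertE hJ.1) ->; rewrite PoszD.
Qed.

End Monomial.

(** * Finite support of the h-vector *)

(** Jump repeatedly to an index at which [f] attains its minimum over the remaining tail. *)
Lemma nondecreasing_subsequence (f : nat -> nat) : exists phi : nat -> nat,
  (forall i j, (i < j)%N -> (phi i < phi j)%N) /\
  (forall i j, (i < j)%N -> (f (phi i) <= f (phi j))%N).
Proof.
have /choice[g hg] N : exists i, (N <= i)%N /\ forall k, (N <= k)%N -> (f i <= f k)%N.
  pose P v := `[< exists2 i, (N <= i)%N & f i = v >].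
  have [] := @ex_minnP P; first by exists (f N); apply/asboolP; exists N.
  move=> v /asboolP[i Ni <-] hmin; exists i; split=> // k Nk.
  by apply: hmin; apply/asboolP; exists k.
pose phi := fix phi k := if k is k'.+1 then g (phi k').+1 else g 0%N.
have lt i j : (i < j)%N -> (phi i < phi j)%N.
  elim: j => // j IH; rewrite ltnS leq_eqVlt => /predU1P[->|/IH h].
    exact: (hg (phi j).+1).1.
  exact: ltn_trans h (hg (phi j).+1).1.
exists phi; split=> // i j /lt h.
by case: i h => [|i] /= h; apply: (hg _).2 => //; have := (hg (phi i).+1).1; lia.
Qed.

(** Pass to a subsequence nondecreasing in one more coordinate at a time. *)
Lemma dickson (r : nat) (u : nat -> 'X_{1..r}) :
  exists i j, (i < j)%N /\ (u i <= u j)%MM.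
Proof.
have H k : exists phi : nat -> nat,
    (forall i j, (i < j)%N -> (phi i < phi j)%N) /\
    forall (a : 'I_r) i j, (a < k)%N -> (i < j)%N -> (u (phi i) a <= u (phi j) a)%N.
  elim: k => [|k [phi [lt h]]]; first by exists id.
  have [kr|rk] := ltnP k r; last first.
    by exists phi; split=> // a i j _; apply: h; apply: leq_trans rk.
  have [psi [lt' h']] := nondecreasing_subsequence (fun i => u (phi i) (Ordinal kr)).
  exists (phi \o psi); split=> [i j /lt'/lt //|a i j].
  rewrite ltnS leq_eqVlt => /predU1P[ak ij|ak /lt' ij]; last exact: h.
  by rewrite (_ : a = Ordinal kr) ?h' //; exact: val_inj.
have [phi [lt h]] := H r; exists (phi 0%N), (phi 1%N); split; first exact: lt.
by apply/mnm_lepP => a; exact: h.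
Qed.

Section Hilbert.
Variables (K : fieldType) (n : nat).
Local Notation R := {mpoly K[n.+1]}.
Local Notation mnm := 'X_{1..n.+1}.
Implicit Types (S : set mnm).

Lemma upset_lem S (m m' : mnm) : upset S -> (m <= m')%MM -> S m -> S m'.
Proof. by move=> up le Sm; rewrite -(submK le) addmC; apply: up. Qed.

(** If every inclusion from [C0] on were strict, new monomials [u c] chosen at each stage would
    contradict Dickson's lemma. *)
Lemma upset_chain_stable (S : nat -> set mnm) C0 :
  (forall c, upset (S c)) -> (forall c, S c `<=` S c.+1) ->
  exists2 C, (C0 <= C)%N & S C.+1 = S C.
Proof.
move=> up inc; apply: contrapT => nst.
have /choice[u hu] c : exists m, S (C0 + c).+1 m /\ ~ S (C0 + c)%N m.
  apply: contrapT => h; apply: nst; exists (C0 + c)%N; first exact: leq_addr.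
  apply/seteqP; split=> [m Sm|]; last exact: inc.
  by apply: contrapT => nSm; apply: h; exists m.
have mono i j : (i <= j)%N -> S i `<=` S j.
  elim: j => [|j IH]; first by rewrite leqn0 => /eqP ->.
  rewrite leq_eqVlt => /predU1P[->//|/IH h] m /h; exact: inc.
have [i [j [ij le]]] := dickson u.
apply: (hu j).2; apply: (upset_lem (up _) le).
by apply: mono (hu i).1; rewrite -addnS leq_add2l.
Qed.

(** No coordinate subspace spanned by [k + 1] of the variables in [B] lies in the zero locus of
    [S]. *)
Definition covers S (B : {set 'I_n.+1}) (k : nat) : Prop :=
  forall A : {set 'I_n.+1}, A \subset B -> #|A| = k.+1 ->
  exists m : mnm, S m /\ forall i, i \notin A -> m i = 0%N.

Lemma hilbZ_full S j : (forall m, mdeg m = j -> S m) -> upset S ->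
  hilbZ (mono_ideal (K := K) S) j = 0.
Proof.
move=> h up; have hI := mono_ideal_is_ideal K up.
rewrite /hilbZ (hilbertE hI (graded_quotient_dim_lead j hI)) lead_set_mono.
rewrite (_ : std_monomials S j = finset.set0) ?cards0 //.
apply/setP => m; rewrite !inE; apply/andP => -[/eqP/h Sm /asboolP]; exact.
Qed.

Definition colon_set S (i : 'I_n.+1) (c : nat) : set mnm :=
  [set m | S (U_(i) *+ c + m)%MM].

Lemma colon_set_upset S i c : upset S -> upset (colon_set S i c).
Proof. by move=> up m m'; rewrite /colon_set /= addmA; exact: up. Qed.

Lemma upsetU S S' : upset S -> upset S' -> upset (S `|` S').
Proof. by move=> h h' m m' [/h Sm|/h' Sm]; [left|right]; exact: Sm. Qed.

Lemma upset_var (i : 'I_n.+1) : upset [set m : mnm | m i != 0%N].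
Proof. by move=> m m' /=; rewrite mnmDE; lia. Qed.

(* The numerical form of dim R/S <= k. *)
Lemma hilbZ_covers (B : {set 'I_n.+1}) k S : upset S ->
  (forall i, i \notin B -> S U_(i)%MM) -> covers S B k ->
  eventually_zero (iter k diff (hilbZ (mono_ideal (K := K) S))).
Proof.
move: {2}#|B| (erefl #|B|) => b; elim: b B k S => [|b IH] B k S cB up SB cov.
  apply: eventually_zero_diff; exists 1%N => j j0; apply: hilbZ_full => // m mj.
  have [i mi] : exists i, m i != 0%N.
    apply: contrapT => h; move: j0; rewrite -mj mdegE big1 // => i _.
    by apply: contrapT => /eqP mi; apply: h; exists i.
  apply: (upset_lem up (m := U_(i)%MM)); first by rewrite lep1mP.
  by apply: SB; move/eqP: cB; rewrite cards_eq0 => /eqP ->; rewrite inE.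
have /card_gt0P[i0 i0B] : (0 < #|B|)%N by rewrite cB.
pose B' := B :\ i0; have cB' : #|B'| = b by apply/eqP; rewrite -eqSS -cB (cardsD1 i0 B) i0B.
pose T c := colon_set S i0 c.
have upT c : upset (T c) by exact: colon_set_upset.
pose Q c := T c `|` [set m | m i0 != 0%N].
have upQ c : upset (Q c) by apply: upsetU => //; exact: upset_var.
have TS c : S `<=` T c by move=> m Sm; rewrite /T /colon_set /= addmC; exact: up.
have Tinc c : T c `<=` T c.+1.
  by move=> m Sm; rewrite /T /colon_set /= mulmS -addmA addmC; exact: up.
have QB c i : i \notin B' -> Q c U_(i)%MM.
  rewrite !inE negb_and negbK => /orP[/eqP ->|/SB]; first by right; rewrite /= mnm1E eqxx.
  by move=> /TS; left.
have covQ c : covers (Q c) B' k.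
  move=> A AB' cA; have [|m [Sm mA]] := cov A _ cA.
    exact: (fintype.subset_trans AB' (subD1set _ _)).
  by exists m; split=> //; left; exact: TS.
have ezQ c : eventually_zero (iter k diff (hilbZ (mono_ideal (K := K) (Q c)))).
  by apply: (IH B') => // i; exact: QB.
(* The exact sequence of multiplication by the variable [i0]: the colon of [T c] is [T c.+1] and the
   sum is [Q c], which lives on the smaller set [B']. *)
have ex c : hilbZ (mono_ideal (K := K) (T c)) =
    shift_seq 1 (hilbZ (mono_ideal (K := K) (T c.+1))) \+ hilbZ (mono_ideal (K := K) (Q c)).
  apply: hilbZ_exact (mono_ideal_adjoin i0 (upT c)).
  - exact: mono_ideal_is_ideal.
  - exact: mono_ideal_homogeneous.
  - exact: (mono_ideal_is_ideal K (upQ c)).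
  - by rewrite dhomogX; apply/eqP; exact: mdeg1.
  - have -> : T c.+1 = [set m | T c (U_(i0) + m)%MM].
      by apply: funext => m; rewrite /T /colon_set /= mulmSr addmA.
    exact: mono_ideal_colon.
(* By [ex] the property passes from [T c.+1] to [T c], hence down to [S = T 0]. *)
suff ezT : exists C, eventually_zero (iter k diff (hilbZ (mono_ideal (K := K) (T C)))).
  have -> : S = T 0%N by apply: funext => m; rewrite /T /colon_set /= mulm0n add0m.
  have [C] := ezT; elim: C => // C IHC h; apply: IHC.
  rewrite ex iter_diffD iter_diff_shift; apply: eventually_zeroD => //.
  exact: eventually_zero_shift.
have /choice[f hf] (A : {set 'I_n.+1}) : exists m : mnm, A \subset B -> #|A| = k.+1 ->
    S m /\ forall i, i \notin A -> m i = 0%N.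
  have [[AB cA]|h] := pselect (A \subset B /\ #|A| = k.+1).
    by have [m hm] := cov A AB cA; exists m.
  by exists 0%MM => AB cA; case: h.
(* Beyond this exponent the colon by a power of [i0] removes [i0] entirely from the covering
   monomials, so sets [A] of one variable fewer suffice. *)
pose C0 := (\max_(A : {set 'I_n.+1}) f A i0)%N.
have [C CC0 TC] := upset_chain_stable C0 upT Tinc; exists C.
have low (A : {set 'I_n.+1}) : A \subset B' -> #|A| = k ->
    exists m : mnm, T C m /\ forall i, i \notin A -> m i = 0%N.
  move=> AB cA; have i0A : i0 \notin A.
    by apply/negP => /(fintype.subsetP AB); rewrite !inE eqxx.
  have [||Sm mA] := hf (i0 |: A).
  - by rewrite finset.subUset finset.sub1set i0B (fintype.subset_trans AB) // subD1set.
  - by rewrite cardsU1 i0A cA.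
  have fC : (f (i0 |: A) i0 <= C)%N.
    by apply: leq_trans CC0; exact: (leq_bigmax (i0 |: A)).
  exists [multinom if i == i0 then 0%N else f (i0 |: A) i | i < n.+1]; split.
    apply: (upset_lem up _ Sm); apply/mnm_lepP => i.
    rewrite mnmDE mulmnE mnm1E mnmE [i == i0]eq_sym; case: eqP => [<-|_]; lia.
  move=> i iA; rewrite mnmE; case: eqP => // /eqP ii0; apply: mA.
  by rewrite !inE negb_or ii0.
(* For [k = 0] the empty set shows that [T C] contains the monomial 1. Otherwise [T C.+1 = T C]
   makes the first difference for [T C] the Hilbert function of [Q C], and the induction applies
   with [k] lowered. *)
case: k cov covQ ezQ hf @C0 CC0 low IH => [|k] cov covQ ezQ hf C0 CC0 low IH.
  have [||m [Tm m0]] := low finset.set0; rewrite ?finset.sub0set ?cards0 //.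
  have {}m0 : m = 0%MM by apply/mnmP => i; rewrite m0 ?inE // mnm0E.
  exists 0%N => j _; apply: hilbZ_full => // m' _.
  by apply: (upset_lem (upT C) _ Tm); rewrite m0; apply/mnm_lepP => i; rewrite mnm0E.
rewrite iterSr.
have -> : diff (hilbZ (mono_ideal (K := K) (T C))) = hilbZ (mono_ideal (K := K) (Q C)).
  apply: funext => j; have := congr1 (@^~ j) (ex C); rewrite TC diffE /shift_seq /=.
  by case: j => [|j] /=; rewrite ?subSS ?subn0; lia.
apply: (IH B') => // [i|A AB' cA]; first exact: QB.
have [m [Tm mA]] := low A AB' cA.
by exists m; split=> //; left.
Qed.

Lemma eventually_zero_hvector (I : set R) : (0 < n)%N -> is_homogeneous_ideal I ->
  (forall i, exists G, [/\ I G, G != 0 & forall m, G@_m != 0 -> m i = 0%N]) ->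
  eventually_zero (hvector I).
Proof.
move=> n0 [hI gI] h; rewrite /hvector.
have -> : (fun j => (hilbert I j)%:Z) = hilbZ (mono_ideal (K := K) (lead_set I)).
  by apply: funext => j; rewrite hilbert_lead.
apply: (@hilbZ_covers [set: _]%SET); first exact: lead_set_upset.
  by move=> i; rewrite inE.
move=> A _; rewrite prednK // => cA.
have /card_gt0P[i] : (0 < #|~: A|)%N by rewrite cardsCs finset.setCK cA card_ord subSnn.
rewrite inE => iA; have [G [IG G0 Gi]] := h i.
have lG := mlead_supp G0; rewrite mcoeff_msupp in lG.
have eA : A = ~: [set i].
  apply/eqP; rewrite eqEcard cardsC1 cA card_ord leqnn andbT.
  by rewrite finset.subsetC finset.sub1set inE.
exists (mlead G); split; last first.
  by move=> i'; rewrite eA !inE negbK => /eqP ->; exact: Gi.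
(* This component keeps the leading monomial of [G], so that monomial belongs to [lead_set I]. *)
exists (pihomog mdeg (mdeg (mlead G)) G); split.
- exact: gI.
- exact: pihomogP.
- by rewrite mcoeff_pihomog eqxx.
- move=> m; rewrite mcoeff_pihomog; case: ifP => [_|_]; last by rewrite eqxx.
  by rewrite -mcoeff_msupp; exact: msupp_le_mlead.
Qed.

End Hilbert.

(** * Counting independent elements modulo an ideal *)

(** Zorn's lemma gives an ideal maximal among those containing [I] and disjoint from the
    multiplicative set [M]; if two factors were outside it, multiplying two elements of [M] would
    show that their product is outside too. *)
Lemma prime_avoiding (A : comNzRingType) (I M : set A) :
  is_ideal I -> M 1 -> (forall f g, M f -> M g -> M (f * g)) ->
  (forall f, I f -> ~ M f) ->
  exists Q, [/\ is_prime_ideal Q, I `<=` Q & forall f, Q f -> ~ M f].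
Proof.
move=> [I0 ID IM] M1 MM IMd.
(* [Zorn_bigcup] also asks for the union of the empty chain, hence [X = set0]. *)
pose P (X : set A) := X = set0 \/ [/\ is_ideal X, I `<=` X & forall f, X f -> ~ M f].
have [|Q [PQ Qmax]] := @Zorn_bigcup A P.
  move=> F FP tot.
  have [[X0 FX0 [f0 X0f0]]|nF] := pselect (exists2 X, F X & X !=set0); last first.
    left; apply/seteqP; split=> // f [X FX Xf].
    by apply: nF; exists X => //; exists f.
  have PX X f : F X -> X f -> [/\ is_ideal X, I `<=` X & forall f, X f -> ~ M f].
    by move=> FX Xf; case: (FP X FX) => // X_0; rewrite X_0 in Xf.
  right; split.
  - split.
    + by exists X0 => //; have [[]] := PX X0 f0 FX0 X0f0.
    + move=> f g [X FX Xf] [Y FY Yg].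
      have [XY|YX] := tot X Y FX FY.
        by exists Y => //; have [[_ h _] _ _] := PX Y g FY Yg; apply: h => //; exact: XY.
      by exists X => //; have [[_ h _] _ _] := PX X f FX Xf; apply: h => //; exact: YX.
    + by move=> r f [X FX Xf]; exists X => //; have [[_ _ h] _ _] := PX X f FX Xf; exact: h.
  - by move=> f If; exists X0 => //; have [_ h _] := PX X0 f0 FX0 X0f0; exact: h.
  - by move=> f [X FX Xf]; have [_ _ h] := PX X f FX Xf; exact: h.
have PI : P I by right; split.
have [hQ IQ QM] : [/\ is_ideal Q, I `<=` Q & forall f, Q f -> ~ M f].
  case: PQ => // Q0; exfalso; apply: (Qmax I _ PI); rewrite Q0; split=> //.
  by move/(_ 0 I0).
have [Q0 QD QM'] := hQ.
(* An element outside Q enlarges Q to an ideal meeting M. *)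
have adj f : ~ Q f -> exists q r, Q q /\ M (q + r * f).
  move=> nQf; apply: contrapT => h.
  pose Q' : set A := [set p | exists2 q, Q q & exists r, p = q + r * f].
  apply: (Qmax Q').
    split; first by move=> q Qq; exists q => //; exists 0; rewrite mul0r addr0.
    by move=> h'; apply: nQf; apply: h'; exists 0 => //; exists 1; rewrite mul1r add0r.
  right; split.
  - split.
    + by exists 0 => //; exists 0; rewrite mul0r addr0.
    + move=> _ _ [q Qq [r ->]] [q' Qq' [r' ->]]; exists (q + q'); first exact: QD.
      by exists (r + r'); rewrite mulrDl addrACA.
    + move=> s _ [q Qq [r ->]]; exists (s * q); first exact: QM'.
      by exists (s * r); rewrite mulrDr mulrA.
  - by move=> q /IQ Qq; exists q => //; exists 0; rewrite mul0r addr0.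
  - by move=> _ [q Qq [r ->]] Mp; apply: h; exists q, r.
exists Q; split=> //; split=> //; first by move=> /QM.
move=> f g Qfg; apply: contrapT => /not_orP[/adj[q [r [Qq M1q]]] /adj[q' [r' [Qq' M2q]]]].
apply: (QM _ _ (MM _ _ M1q M2q)).
rewrite mulrDl; apply: (QD _ _); first by rewrite mulrC; exact: QM'.
rewrite mulrDr; apply: (QD _ _); first exact: QM'.
rewrite (_ : r * f * (r' * g) = (r * r') * (f * g)); first exact: QM'.
by rewrite mulrACA.
Qed.

Section Growth.
Variables (K : fieldType) (n : nat).
Local Notation R := {mpoly K[n.+1]}.
Local Notation mnm := 'X_{1..n.+1}.
Implicit Types (I J Q : set R).

(* For prime I this says that the transcendence degree of R/I is at least k. *)
Definition growth_ge I (k : nat) : Prop := exists D, forall N,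
  exists (T : finType) (e : T -> R),
    [/\ #|T| = (N ^ k)%N, forall t, (msize (e t) <= (N * D).+1)%N & indep_mod I e].

Lemma growth_ge0 I : is_ideal I -> ~ I 1 -> growth_ge I 0.
Proof.
move=> hI nI1; exists 0%N => N; exists 'I_1, (fun=> 1); split.
- by rewrite card_ord.
- by move=> _; rewrite msize1.
- move=> c; rewrite big_ord1 => Ic t; rewrite ord1; apply/eqP; apply: contraPT Ic => c0 Ic.
  by apply: nI1; rewrite -[1](scalerK c0); exact: (idealZ hI).
Qed.

Lemma msizeX_le (g : R) a : (msize (g ^+ a) <= (a * msize g).+1)%N.
Proof.
elim: a => [|a IH]; first by rewrite expr0 msize1.
have [->|g0] := eqVneq g 0; first by rewrite expr0n msize0.
have ga0 : g ^+ a != 0 by rewrite expf_neq0.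
by rewrite exprS msizeM // mulSn -addnS (leq_trans (leq_pred _)) // leq_add2l.
Qed.

(** The products [g ^+ a * e t] with [a < N] are independent modulo [I]. They number [N] times as
    many, and their degrees stay linear in [N]. *)
Lemma growth_geS I Q g k : is_ideal I -> is_ideal Q -> I `<=` Q -> Q g ->
  (forall h, I (g * h) -> I h) -> growth_ge Q k -> growth_ge I k.+1.
Proof.
move=> hI hQ IQ Qg nzd [D hD]; exists (D + msize g)%N => N.
have [T [e [cT sT indT]]] := hD N.
exists ('I_N * T)%type, (fun at_ : 'I_N * T => g ^+ at_.1 * e at_.2); split.
- by rewrite card_prod card_ord cT expnS.
- move=> [a t] /=; have [->|e0] := eqVneq (e t) 0; first by rewrite mulr0 msize0.
  have [->|g0] := eqVneq (g ^+ a) 0; first by rewrite mul0r msize0.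
  have h : (msize (g ^+ a) <= (N * msize g).+1)%N.
    by rewrite (leq_trans (msizeX_le g a)) // ltnS leq_mul2r ltnW ?orbT.
  rewrite msizeM // mulnDr; apply: leq_trans (_ : ((N * msize g).+1 + (N * D).+1).-1 <= _)%N.
    by rewrite -!subn1 leq_sub2r // leq_add.
  by rewrite addSn addnS addnC.
(* Read a relation modulo [Q]: only [a = 0] survives, so its coefficients vanish; then cancel one
   factor [g] modulo [I] and repeat. *)
have main M (c : nat -> T -> K) : I (\sum_(a < M) g ^+ a * \sum_t c a t *: e t) ->
    forall a t, (a < M)%N -> c a t = 0.
  elim: M c => [|M IH] c // Ic; set E := fun a : nat => \sum_t c a t *: e t.
  have eE : \sum_(a < M.+1) g ^+ a * E a =
      E 0%N + g * \sum_(a < M) g ^+ a * E a.+1.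
    rewrite big_ord_recl mul1r; congr (_ + _); rewrite mulr_sumr.
    by apply: eq_bigr => a _; rewrite mulrA -exprS.
  rewrite -/E eE in Ic.
  have c0 : forall t, c 0%N t = 0.
    apply: indT; have := idealB hQ (IQ _ Ic) (idealMr hQ (\sum_(a < M) g ^+ a * E a.+1) Qg).
    by rewrite addrK.
  have E0 : E 0%N = 0 by rewrite /E big1 // => t _; rewrite c0 scale0r.
  rewrite E0 add0r in Ic; have {}IH := IH (fun a => c a.+1) (nzd _ Ic).
  by case=> [|a] t; [rewrite c0|move=> aM; exact: IH].
move=> c Ic [a t].
pose c' (a : nat) t := if insub a is Some a' then c (a', t) else 0.
have c'E (b : 'I_N) s : c' b s = c (b, s) by rewrite /c' valK.
rewrite -c'E; apply: (main N) => //.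
congr I: Ic; rewrite (eq_bigr (fun p => c (p.1, p.2) *: (g ^+ p.1 * e p.2))); last by case.
rewrite -(pair_bigA _ (fun b s => c (b, s) *: (g ^+ b * e s))) /=.
apply: eq_bigr => b _; rewrite mulr_sumr; apply: eq_bigr => s _.
by rewrite c'E scalerAr.
Qed.

Lemma card_bmnm_le d : (#|{: 'X_{1..n.+1 < d}}| <= d ^ n.+1)%N.
Proof.
pose f (m : 'X_{1..n.+1 < d}) : {ffun 'I_n.+1 -> 'I_d} :=
  [ffun i => Ordinal (leq_ltn_trans (leq_trans (leq_addr _ _)
     (eq_leq (esym (etrans (mdegE (val m)) (bigD1 i isT))))) (bmdeg m))].
have /leq_card : injective f.
  move=> m1 m2 /ffunP e; apply/val_inj/mnmP => i.
  by have := congr1 val (e i); rewrite !ffunE.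
by rewrite card_ffun !card_ord.
Qed.

Lemma growth_le I : is_ideal I -> ~ growth_ge I n.+2.
Proof.
(* At most [(N * D.+1) ^ n.+1] monomials have degree at most [N * D], and this [N] makes that number
   smaller than [N ^ n.+2]. *)
move=> hI [D hD]; pose N := (D.+1 ^ n.+1).+1.
have [T [e [cT sT indT]]] := hD N.
have : (#|T| <= #|{: 'X_{1..n.+1 < (N * D).+1}}|)%N.
  apply: (@indep_le_span K n I T 'X_{1..n.+1 < (N * D).+1} e (fun w => 'X_[val w])) => // t.
  exists (fun w => (e t)@_(val w)); rewrite -mpolywE ?subrr //; exact: ideal0.
apply/negP; rewrite -ltnNge cT; apply: leq_ltn_trans (card_bmnm_le _) _.
have N0 : (0 < N)%N by [].
have le : ((N * D).+1 <= N * D.+1)%N by rewrite mulnS; lia.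
apply: leq_ltn_trans (_ : (N ^ n.+1 * D.+1 ^ n.+1 < _)%N).
  by rewrite -expnMn leq_exp2r.
by rewrite [X in (_ < X)%N]expnSr ltn_pmul2l ?expn_gt0.
Qed.

(** The [N ^ n] monomials in the other variables with exponents below [N] are independent modulo
    [Q]. *)
Lemma growth_ge_avoid Q (i0 : 'I_n.+1) :
  (forall G, Q G -> (forall m, G@_m != 0 -> m i0 = 0%N) -> G = 0) -> growth_ge Q n.
Proof.
move=> h; exists n.+1 => N.
pose mn (t : {ffun 'I_n -> 'I_N}) : mnm :=
  [multinom if unlift i0 i is Some k then t k : nat else 0%N | i < n.+1].
have mn_inj : injective mn.
  move=> t1 t2 /mnmP e; apply/ffunP => k; apply: val_inj.
  by have := e (lift i0 k); rewrite !mnmE liftK.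
exists {ffun 'I_n -> 'I_N}, (fun t => 'X_[mn t]); split.
- by rewrite card_ffun !card_ord.
- move=> t; rewrite msizeX ltnS mdegE -[X in (_ <= X * _)%N]muln1.
  rewrite mulnC muln1 -[X in (_ <= X * _)%N](card_ord n.+1) -sum_nat_const.
  apply: leq_sum => i _; rewrite mnmE; case: (unlift i0 i) => // k; exact: ltnW.
- move=> c Qc t; have G0 := h _ Qc.
  have coef : (\sum_t c t *: 'X_[mn t] : R)@_(mn t) = c t.
    rewrite raddf_sum /= (bigD1 t) //= big1 ?addr0.
      by rewrite mcoeffZ mcoeffX eqxx mulr1.
    move=> s st; rewrite mcoeffZ mcoeffX (inj_eq mn_inj) (negPf st) mulr0 //.
  rewrite -coef G0 ?mcoeff0 // => m; rewrite -mcoeff_msupp.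
  move=> /msupp_sum_le /flattenP[s /mapP[u _ ->]] /msuppZ_le.
  by rewrite msuppX inE => /eqP ->; rewrite mnmE unlift_none.
Qed.

Lemma growth_ge_proper P Q k : is_prime_ideal P -> is_prime_ideal Q -> P `<` Q ->
  growth_ge Q k -> growth_ge P k.+1.
Proof.
move=> [hP _ pP] [hQ _ _] [PQ nQP].
have [g [Qg nPg]] : exists g, Q g /\ ~ P g.
  by apply: contrapT => h; apply: nQP => g Qg; apply: contrapT => nPg; apply: h; exists g.
by apply: (growth_geS hP hQ PQ Qg) => h /pP[].
Qed.

Lemma growth_ge_chain (P : nat -> set R) k j :
  prime_chain P k -> growth_ge (P k) j -> growth_ge (P 0%N) (k + j).
Proof.
move=> [pr inc] h.
suff main i : (i <= k)%N -> growth_ge (P (k - i)%N) (i + j).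
  by have := main k (leqnn k); rewrite subnn.
elim: i => [|i IH] ik; first by rewrite subn0.
apply: (growth_ge_proper _ _ _ (IH (ltnW ik))); try by apply: pr; lia.
by have := inc (k - i.+1)%N; rewrite -subSn // subSS; apply; lia.
Qed.

Lemma height2_elimination I (i0 : 'I_n.+1) : is_ideal I -> height_ge I 2 ->
  exists G, [/\ I G, G != 0 & forall m, G@_m != 0 -> m i0 = 0%N].
Proof.
move=> hI ht; apply: contrapT => nG.
(* A multiplicative set, as [R] is a domain; if it misses [I], a prime avoiding it has too much
   growth to sit on top of a chain of length 2. *)
pose M : set R := [set G | G != 0 /\ forall m, G@_m != 0 -> m i0 = 0%N].
have [|f g [f0 hf] [g0 hg]|f If [f0 hf]|Q [pQ IQ QM]] := @prime_avoiding _ I M hI.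
- split; first exact: oner_neq0.
  by move=> m; rewrite -mpolyX0 mcoeffX_neq0 => /eqP <-; rewrite mnm0E.
- split; first by rewrite mulf_neq0.
  move=> m; rewrite -mcoeff_msupp => /msuppM_le /allpairsP[[k1 k2] /= [h1 h2 ->]].
  by rewrite mnmDE hf ?hg // -mcoeff_msupp.
- by apply: nG; exists f.
have [P [cP PQ]] := ht Q pQ IQ.
have gQ : growth_ge Q n.
  apply: (@growth_ge_avoid _ i0) => G QG hG; apply/eqP; apply: contraPT QG => G0 QG.
  by apply: (QM G).
rewrite -PQ in gQ; have := growth_ge_chain cP gQ; rewrite add2n.
by apply: growth_le; have [/(_ 0%N isT) []] := cP.
Qed.

End Growth.

(** * The Cohen-Macaulay ideal with prescribed h-vector *)

Section ACM.
Variables (K : fieldType) (n : nat).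
Local Notation R := {mpoly K[n.+1]}.
Local Notation mnm := 'X_{1..n.+1}.
Implicit Types (I J Q : set R) (S : set mnm).

Lemma upset0 : upset (set0 : set mnm). Proof. by []. Qed.

Lemma mono_ideal0 (f : R) : mono_ideal set0 f <-> f = 0.
Proof.
split=> [h|-> m]; last by rewrite mcoeff0 eqxx.
by apply/mpolyP => m; rewrite mcoeff0; apply/eqP; apply: contrapT => /negP /h.
Qed.

Lemma mono_ideal_sub_mono S S' : S `<=` S' -> mono_ideal (K := K) S `<=` mono_ideal S'.
Proof. by move=> SS' f hf m /hf /SS'. Qed.

(** Discard the monomials of both factors lying in [S]. The product of the remainders has no
    monomial in [S], so if it is in the ideal it is 0, and [R] is a domain. *)
Lemma mono_ideal_prime S : upset S -> ~ S 0%MM ->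
  (forall m m', S (m + m')%MM -> S m \/ S m') -> is_prime_ideal (mono_ideal (K := K) S).
Proof.
move=> up S0 hS; have hI := mono_ideal_is_ideal K up.
split=> //; first by rewrite -mpolyX0 => /mono_idealX.
have spl f : exists f2 : R, mono_ideal S (f - f2) /\ forall m, f2@_m != 0 -> ~ S m.
  exists (\sum_(m <- msupp f | `[< ~ S m >]) f@_m *: 'X_[m]); split.
    rewrite [X in X - _]mpolyE (bigID (fun m : mnm => `[< ~ S m >])) /= addrAC subrr add0r.
    apply: (ideal_sum hI) => m /asboolPn /contrapT Sm.
    by apply: (idealZ hI); apply/mono_idealX.
  move=> m; rewrite -mcoeff_msupp -big_filter.
  move=> /msupp_sum_le /flattenP[s /mapP[u uf ->]] /msuppZ_le.
  by rewrite msuppX inE => /eqP ->; move: uf; rewrite !mem_filter /= => /andP[/asboolP].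
move=> f g fg; have [f2 [hf f2S]] := spl f; have [g2 [hg g2S]] := spl g.
have fg2 : mono_ideal S (f2 * g2).
  rewrite (_ : f2 * g2 = f * g - (f - f2) * g - f2 * (g - g2)).
    apply: (idealB hI); last exact: (idealM hI).
    by apply: (idealB hI) => //; exact: (idealMr hI).
  by rewrite mulrBl mulrBr !opprB [f * g + _]addrC subrK addrC subrK.
have /eqP : f2 * g2 = 0.
  apply/mono_ideal0 => m fgm; have Sm := fg2 _ fgm.
  move: fgm; rewrite -mcoeff_msupp => /msuppM_le /allpairsP[[k1 k2] /= [h1 h2 em]].
  rewrite !mcoeff_msupp in h1 h2.
  by rewrite em in Sm; case: (hS _ _ Sm) => [/(f2S _ h1)|/(g2S _ h2)].
rewrite mulf_eq0 => /orP[/eqP e|/eqP e]; [left|right].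
  by rewrite e subr0 in hf.
by rewrite e subr0 in hg.
Qed.

Lemma mono_ideal_nzd S k (h : R) : (forall m, S (k + m)%MM -> S m) ->
  mono_ideal S ('X_[k] * h) -> mono_ideal S h.
Proof.
by move=> hS Skh m hm; apply/hS/Skh; rewrite mulrC mcoeffMX.
Qed.

(** On monomials: [X_i] is a non-zero-divisor modulo [S]. *)
Definition free_var S (i : 'I_n.+1) : Prop := forall m, S (U_(i) + m)%MM -> S m.

Definition add_var S (i : 'I_n.+1) : set mnm := S `|` [set m | m i != 0%N].

Lemma add_var_upset S i : upset S -> upset (add_var S i).
Proof. by move=> up; apply: upsetU => //; exact: upset_var. Qed.

Lemma free_add_var S i j : i != j -> free_var S j -> free_var (add_var S i) j.
Proof.
move=> ij h m [/h|]; first by left.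
by rewrite /= mnmDE mnm1E [j == i]eq_sym (negPf ij) add0n; right.
Qed.

Lemma foldl_add_varE S l m :
  foldl add_var S l m <-> S m \/ exists2 i, i \in l & m i != 0%N.
Proof.
elim: l S => [|i l IH] S /=; first by split=> [|[//|[]//]]; left.
rewrite IH; split=> [[[Sm|mi]|[j jl mj]]|[Sm|[j]]].
- by left.
- by right; exists i => //; rewrite mem_head.
- by right; exists j => //; rewrite inE jl orbT.
- by left; left.
- by rewrite inE => /predU1P[-> mi|jl mj]; [left; right|right; exists j].
Qed.

Lemma regular_on_mono_ideal l S : upset S -> uniq l ->
  (forall i, i \in l -> free_var S i) ->
  regular_on_quotient (mono_ideal S) [seq 'X_i : R | i <- l].
Proof.
elim: l S => //= i l IH S up /andP[il ul] fr; split.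
  by move=> g; apply: mono_ideal_nzd; apply: fr; rewrite mem_head.
have -> : ideal_adjoin (mono_ideal S) 'X_i = mono_ideal (K := K) (add_var S i).
  by apply/seteqP; split=> f /(mono_ideal_adjoin i up f).
apply: IH => //; first exact: add_var_upset.
move=> j jl; apply: free_add_var; last by apply: fr; rewrite inE jl orbT.
by apply: contraNneq il => ->.
Qed.

Lemma diff_hilbZ_free S i : upset S -> free_var S i ->
  diff (hilbZ (mono_ideal (K := K) S)) = hilbZ (mono_ideal (K := K) (add_var S i)).
Proof.
move=> up fr; have hI := mono_ideal_is_ideal K up.
have := @hilbZ_exact K n (mono_ideal S) (mono_ideal S) (mono_ideal (add_var S i)) 'X_i 1 hI
  (mono_ideal_homogeneous K up) (mono_ideal_is_ideal K (add_var_upset up)).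
have -> : ('X_i : R) \is 1.-homog by rewrite dhomogX; apply/eqP; exact: mdeg1.
have hc : colon_mod (mono_ideal (K := K) S) (mono_ideal S) 'X_i.
  have {1}-> : S = [set m | S (U_(i) + m)%MM].
    by apply/seteqP; split=> m; [rewrite /= addmC; exact: up|exact: fr].
  exact: mono_ideal_colon.
move=> /(_ isT hc (mono_ideal_adjoin i up)) e.
apply: funext => j; have := congr1 (@^~ j) e; rewrite diffE /shift_seq /=.
by case: j => [|j] /=; rewrite ?subSS ?subn0; lia.
Qed.

Lemma iter_diff_hilbZ l S : upset S -> uniq l -> (forall i, i \in l -> free_var S i) ->
  iter (size l) diff (hilbZ (mono_ideal (K := K) S)) =
  hilbZ (mono_ideal (K := K) (foldl add_var S l)).
Proof.
elim: l S => //= i l IH S up /andP[il ul] fr.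
have fi : free_var S i by apply: fr; rewrite mem_head.
rewrite -iterS iterSr (diff_hilbZ_free up fi) IH //; first exact: add_var_upset.
move=> j jl; apply: free_add_var; last by apply: fr; rewrite inE jl orbT.
by apply: contraNneq il => ->.
Qed.

Lemma ideal_adjoin_is_ideal I f : is_ideal I -> is_ideal (ideal_adjoin I f).
Proof.
move=> hI; split.
- by exists 0; rewrite mul0r subr0; exact: ideal0.
- move=> g h [q Iq] [r Ir]; exists (q + r); rewrite mulrDl opprD addrACA.
  exact: idealD.
- by move=> r g [q Iq]; exists (r * q); rewrite -mulrA -mulrBr; exact: idealM.
Qed.

(** Each regular element raises the exponent by one through [growth_geS]; membership in the
    irrelevant ideal keeps the last quotient nonzero. *)
Lemma growth_ge_regular I fs : is_ideal I -> I `<=` @irrelevant_ideal K n ->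
  (forall f, f \in fs -> @irrelevant_ideal K n f) -> regular_on_quotient I fs ->
  growth_ge I (size fs).
Proof.
elim: fs I => [|f fs IH] I hI Im fm /=.
  by move=> _; apply: growth_ge0 => // /Im; rewrite /irrelevant_ideal /= mcoeff1 eqxx => /eqP;
    rewrite oner_eq0.
move=> [nzd reg]; have hI' := ideal_adjoin_is_ideal f hI.
apply: (growth_geS hI hI' _ _ nzd).
- by move=> g Ig; exists 0; rewrite mul0r subr0.
- by exists 1; rewrite mul1r subrr; exact: ideal0.
apply: IH => // [g [q /Im]|g gfs]; last by apply: fm; rewrite inE gfs orbT.
have := fm f (mem_head _ _); rewrite /irrelevant_ideal /= mcoeffB.
have /= -> := rmorphM (mcoeff (0%MM : mnm) : {rmorphism R -> K}) q f.
by move=> ->; rewrite mulr0 subr0.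
Qed.

Hypothesis hn : (2 <= n)%N.
Let i1 : 'I_n.+1 := inord 1.

Lemma val_i1 : i1 = 1%N :> nat. Proof. by rewrite inordK // ltnS ltnW. Qed.

Lemma i1_neq0 : i1 != ord0. Proof. by rewrite -val_eqE /= val_i1. Qed.

(** With [J = (x_0^q)], the power [x_1^q] is regular modulo [J] and [x_0^q] is regular modulo 0. Two
    applications of [growth_geS] would give the zero ideal growth [n + 2]. *)
Lemma not_growth_ge_powers I q : is_ideal I ->
  I 'X_[U_(ord0) *+ q] -> I 'X_[U_(i1) *+ q] -> ~ growth_ge I n.
Proof.
move=> hI I0 I1 gI; pose J : set R := mono_ideal [set m | (q <= m ord0)%N].
have upJ : upset [set m : mnm | (q <= m ord0)%N].
  by move=> m m' /=; rewrite mnmDE => /leq_trans; apply; exact: leq_addr.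
have hJ : is_ideal J := mono_ideal_is_ideal K upJ.
have JI : J `<=` I.
  apply: mono_ideal_sub => // m /= qm.
  have le : (U_(ord0) *+ q <= m)%MM.
    apply/mnm_lepP => i; rewrite mulmnE mnm1E; case: eqP => [<-|//].
    by rewrite mul1n.
  by rewrite -(submK le) mpolyXD; exact: idealM.
have gJ : growth_ge J n.+1.
  apply: (growth_geS hJ hI JI I1) => // h; apply: mono_ideal_nzd => m /=.
  by rewrite mnmDE mulmnE mnm1E (negPf i1_neq0).
have h0 := mono_ideal_is_ideal K upset0.
apply: (growth_le h0); apply: (growth_geS (g := 'X_[U_(ord0) *+ q]) h0 hJ _ _ _ gJ).
- by move=> f /mono_ideal0 ->; exact: ideal0.
- by apply/mono_idealX; rewrite /= mulmnE mnm1E eqxx mul1n.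
- by move=> h; exact: mono_ideal_nzd.
Qed.

Let tail : seq 'I_n.+1 := [seq i : 'I_n.+1 <- enum 'I_n.+1 | (1 < i)%N].

Lemma mem_tail i : (i \in tail) = (1 < i)%N.
Proof. by rewrite mem_filter mem_enum andbT. Qed.

Lemma uniq_tail : uniq tail. Proof. by rewrite filter_uniq // enum_uniq. Qed.

Lemma notin_tail (i : 'I_n.+1) : ~~ (1 < i)%N -> i = ord0 \/ i = i1.
Proof.
move=> h; have [i0|i0] := eqVneq i ord0; [by left|right].
by apply/val_inj; rewrite /= val_i1; move: i0; rewrite -val_eqE /=; lia.
Qed.

Lemma size_tail : size tail = n.-1.
Proof.
rewrite -(size_map val) /tail -filter_map val_enum_ord.
case: n hn => [//|[//|k]] _ /=; congr _.+1.
rewrite (_ : filter _ _ = iota 3 k) ?size_iota //.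
by apply/all_filterP/allP => x; rewrite mem_iota /=; lia.
Qed.

(** In degree [j] of [K[x_0, x_1]] the monomials left outside are [x_0^(j-k) x_1^k] with
    [k < b j]. *)
Definition corner_set (b : nat -> nat) : set mnm := [set m | (b (m ord0 + m i1) <= m i1)%N].

Section Corner.
Variables (b : nat -> nat).
Hypotheses (bni : forall j, (b j <= j)%N -> (b j.+1 <= b j)%N).

(** Membership gives [b (p + q) <= q <= p + q], and from such an index on [b] does not increase. *)
Lemma corner_upset : upset (corner_set b).
Proof.
move=> m m'; rewrite /corner_set /= !mnmDE => h.
apply: leq_trans (leq_trans h (leq_addr _ _)); apply: noninc_from bni _ _; lia.
Qed.

Lemma corner_free i : i \in tail -> free_var (corner_set b) i.
Proof.
rewrite mem_tail => hi m; rewrite /corner_set /= !mnmDE !mnm1E.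
have -> : (i == ord0) = false by apply: contraTF hi => /eqP ->.
have -> : (i == i1) = false by apply: contraTF hi => /eqP ->; rewrite val_i1.
by rewrite !add0n.
Qed.

Hypothesis b_le : forall j, (b j <= j.+1)%N.

Lemma corner_hilbert j :
  hilbert (mono_ideal (K := K) (foldl add_var (corner_set b) tail)) j = b j.
Proof.
set S := foldl _ _ _.
have up : upset S.
  move=> m m' /foldl_add_varE h; apply/foldl_add_varE.
  case: h => [h|[i it mi]]; first by left; exact: corner_upset.
  by right; exists i => //; rewrite mnmDE; lia.
apply: hilbertE; first exact: mono_ideal_is_ideal.
(* For [k < b j] the hypothesis [b_le] gives [k <= j], so the truncated subtraction is exact and the
   degree is [j]. *)
pose mk k : mnm := (U_(ord0) *+ (j - k) + U_(i1) *+ k)%MM.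
have mk0 k : mk k ord0 = (j - k)%N.
  by rewrite mnmDE !mulmnE !mnm1E eqxx (negPf i1_neq0) mul1n mul0n addn0.
have mk1 k : mk k i1 = k.
  by rewrite mnmDE !mulmnE !mnm1E eqxx eq_sym (negPf i1_neq0) mul1n mul0n.
have mkt k i : i \in tail -> mk k i = 0%N.
  rewrite mem_tail => hi; rewrite mnmDE !mulmnE !mnm1E.
  have -> : (ord0 == i) = false by apply: contraTF hi => /eqP <-.
  have -> : (i1 == i) = false by apply: contraTF hi => /eqP <-; rewrite val_i1.
  by rewrite !mul0n.
have coef (c : 'I_(b j) -> K) (k : 'I_(b j)) : (\sum_k c k *: 'X_[mk k] : R)@_(mk k) = c k.
  rewrite raddf_sum /= (bigD1 k) //= big1 ?addr0.
    by rewrite mcoeffZ mcoeffX eqxx mulr1.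
  move=> l lk; rewrite mcoeffZ mcoeffX; case: (mk l =P mk k) => [e|_]; last by rewrite mulr0.
  by move: lk; rewrite -val_eqE /= -(mk1 l) e mk1 eqxx.
exists (fun k => 'X_[mk k]); split.
- move=> k; rewrite dhomogX; apply/eqP; rewrite /= mdegD !mdegMn !mdeg1 !mul1n subnK //.
  by have := b_le j; have := ltn_ord k; lia.
- move=> c Sc k; apply/eqP; apply: contrapT => /negP ck.
  have /foldl_add_varE : S (mk k) by apply: Sc; rewrite coef.
  case=> [|[i it]]; last by rewrite mkt.
  rewrite /corner_set /= mk0 mk1 subnK; first by rewrite leqNgt ltn_ord.
  by have := b_le j; have := ltn_ord k; lia.
- move=> f hf; exists (fun k => f@_(mk k)) => m.
  have [[k ->]|nk] := pselect (exists k : 'I_(b j), m = mk k).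
    by rewrite mcoeffB (coef (fun k : 'I_(b j) => f@_(mk k))) subrr eqxx.
  rewrite mcoeffB [X in _ - X](_ : _ = 0); last first.
    rewrite raddf_sum /= big1 // => k _; rewrite mcoeffZ mcoeffX.
    by case: eqP => [e|_]; [case: nk; exists k|rewrite mulr0].
  rewrite subr0 => fm; apply/foldl_add_varE; apply: contrapT => /not_orP[nS nt].
  have mt i : i \in tail -> m i = 0%N.
    by move=> it; apply/eqP; apply: contrapT => /negP mi; apply: nt; exists i.
  have dm : (m ord0 + m i1)%N = j.
    have <- : mdeg m = j by apply: (dhomog_mf hf); rewrite mcoeff_msupp.
    rewrite mdegE (bigD1 ord0) //= (bigD1 i1) ?i1_neq0 //= big1 ?addn0 // => i /andP[h0 h1].
    apply: mt; rewrite mem_tail; apply: contrapT => /negP /notin_tail[e|e].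
      by rewrite e eqxx in h0.
    by rewrite e eqxx in h1.
  move: nS; rewrite /corner_set /= dm => /negP; rewrite -ltnNge => lt.
  apply: nk; exists (Ordinal lt); apply/mnmP => i /=.
  have [it|] := boolP (i \in tail); first by rewrite mt // mkt.
  rewrite mem_tail => /notin_tail[->|->]; first by rewrite mk0; lia.
  by rewrite mk1.
Qed.

Lemma corner_hvector j : hvector (mono_ideal (K := K) (corner_set b)) j = (b j)%:Z.
Proof.
rewrite /hvector -size_tail (iter_diff_hilbZ corner_upset uniq_tail corner_free).
by rewrite /hilbZ corner_hilbert.
Qed.

End Corner.

Lemma hvector_zero j : hvector (mono_ideal (K := K) (set0 : set mnm)) j = j.+1%:Z.
Proof.
(* The zero ideal is the corner ideal of [b = succn], since [p + q + 1 <= q] is impossible. *)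
rewrite -(@corner_hvector succn) //; congr (hvector (mono_ideal _) _).
by apply/seteqP; split=> // m; rewrite /corner_set /=; lia.
Qed.

(** * Height, dimension, depth and saturation of the corner ideal *)

Section CornerACM.
Variables (b : nat -> nat) (q : nat).
Hypotheses (bni : forall j, (b j <= j)%N -> (b j.+1 <= b j)%N).
Hypotheses (b0 : b 0%N = 1%N) (bq : b q = 0%N).
Let IY : set R := mono_ideal (corner_set b).

Let hIY : is_ideal IY. Proof. exact/mono_ideal_is_ideal/corner_upset. Qed.

Lemma corner_x0 : IY 'X_[U_(ord0) *+ q].
Proof.
apply/mono_idealX; rewrite /corner_set /= !mulmnE !mnm1E eqxx eq_sym (negPf i1_neq0).
by rewrite mul1n mul0n addn0 bq.
Qed.

Lemma corner_x1 : IY 'X_[U_(i1) *+ q].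
Proof.
apply/mono_idealX; rewrite /corner_set /= !mulmnE !mnm1E eqxx (negPf i1_neq0).
by rewrite mul1n mul0n add0n bq.
Qed.

Lemma corner_neq0 m : corner_set b m -> m ord0 != 0%N \/ m i1 != 0%N.
Proof.
rewrite /corner_set /=; have [->|] := eqVneq (m ord0) 0%N; last by left.
by have [->|] := eqVneq (m i1) 0%N; [rewrite b0|right].
Qed.

Lemma corner_irrelevant : IY `<=` @irrelevant_ideal K n.
Proof.
move=> f hf; apply/eqP; apply: contrapT => /negP /hf /corner_neq0.
by rewrite !mnm0E; case.
Qed.

Lemma tail_irrelevant (f : R) : f \in [seq 'X_i : R | i <- tail] -> @irrelevant_ideal K n f.
Proof.
by case/mapP => i _ ->; rewrite /irrelevant_ideal /= mcoeffX mnm1_eq0.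
Qed.

Definition vars_set (k : nat) : set mnm := [set m | exists2 i : 'I_n.+1, (i < k)%N & m i != 0%N].

Lemma vars_set_upset k : upset (vars_set k).
Proof. by move=> m m' [i ik mi]; exists i => //; rewrite mnmDE; lia. Qed.

Lemma vars_set_prime k : is_prime_ideal (mono_ideal (K := K) (vars_set k)).
Proof.
apply: mono_ideal_prime; first exact: vars_set_upset.
  by case=> i _; rewrite mnm0E.
move=> m m' [i ik]; rewrite mnmDE addn_eq0 negb_and => /orP[h|h]; [left|right]; by exists i.
Qed.

Lemma vars_set_proper k : (k <= n)%N ->
  mono_ideal (K := K) (vars_set k) `<` mono_ideal (vars_set k.+1).
Proof.
move=> kn; split.
  by apply: mono_ideal_sub_mono => m [i ik mi]; exists i => //; rewrite ltnW.
move=> /(_ 'X_(Ordinal (kn : (k < n.+1)%N))) /(_ _)/mono_idealX -[].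
  by apply/mono_idealX; exists (Ordinal (kn : (k < n.+1)%N)); rewrite ?mnm1E ?eqxx /=.
move=> i ik; rewrite mnm1E eqb0 negbK => /eqP e; by rewrite -e ltnn in ik.
Qed.

Lemma corner_sub_vars k : (1 < k)%N -> IY `<=` mono_ideal (vars_set k).
Proof.
move=> k1; apply: mono_ideal_sub_mono => m /corner_neq0[h|h].
  by exists ord0 => //; exact: ltnW.
by exists i1 => //; rewrite val_i1.
Qed.

Lemma prime_power Q (f : R) k : is_prime_ideal Q -> Q (f ^+ k) -> Q f.
Proof.
move=> [_ n1 pQ]; elim: k => [/n1//|k IH]; rewrite exprS => /pQ[//|/IH//].
Qed.

Lemma corner_height2 : height_ge IY 2.
Proof.
move=> Q pQ IQ; have hQ : is_ideal Q by case: pQ.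
have Q0 : Q 'X_ord0 by apply: (prime_power (k := q)) => //; rewrite mpolyXn; exact/IQ/corner_x0.
have Q1 : Q 'X_i1 by apply: (prime_power (k := q)) => //; rewrite mpolyXn; exact/IQ/corner_x1.
(* The chain is 0, [(x_0)], [Q]; the last inclusion is strict because [x_1] is in [Q]. *)
exists (fun i => if (i < 2)%N then mono_ideal (vars_set i) else Q); split=> //; split.
  by move=> i _; case: ifP => // _; exact: vars_set_prime.
case=> [|[|//]] _ /=; first exact: vars_set_proper.
split.
  apply: mono_ideal_sub => // m [i i1' mi].
  have e : i = ord0 by apply/val_inj => /=; lia.
  have le : (U_(ord0) <= m)%MM by rewrite lep1mP -e.
  by rewrite -(submK le) mpolyXD; exact: idealM.
move=> /(_ _ Q1)/mono_idealX -[i ilt]; rewrite mnm1E eqb0 negbK => /eqP e.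
by rewrite -e val_i1 in ilt.
Qed.

(** Modulo the prime [(x_0, x_1)] the other variables form a regular sequence, so it has growth
    [n - 1]; a chain of length 3 ending there would give growth [n + 2]. *)
Lemma corner_not_height3 : ~ height_ge IY 3.
Proof.
move=> /(_ _ (vars_set_prime 2) (corner_sub_vars (leqnn 2)))[P [cP P3]].
have g : growth_ge (mono_ideal (K := K) (vars_set 2)) n.-1.
  rewrite -size_tail -(size_map (fun i => 'X_i : R)); apply: growth_ge_regular.
  - exact/mono_ideal_is_ideal/vars_set_upset.
  - move=> f hf; apply/eqP; apply: contrapT => /negP /hf [i _].
    by rewrite mnm0E.
  - exact: tail_irrelevant.
  - apply: regular_on_mono_ideal uniq_tail _; first exact: vars_set_upset.
    move=> i; rewrite mem_tail => hi m [j j2]; rewrite mnmDE mnm1E.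
    have -> : (i == j) = false by apply: contraTF hi => /eqP ->; rewrite -leqNgt.
    by exists j.
rewrite -P3 in g; have := growth_ge_chain cP g.
have -> : (3 + n.-1 = n.+2)%N by lia.
by apply: growth_le; have [/(_ 0%N isT) []] := cP.
Qed.

Lemma corner_dim : has_quotient_dim IY n.-1.
Proof.
split.
  (* The chain climbs from [(x_0, x_1)] to [(x_0, ..., x_n)]. *)
  exists (fun i => mono_ideal (vars_set i.+2)); split; last exact: corner_sub_vars.
  split=> [i _|i ik]; first exact: vars_set_prime.
  by apply: vars_set_proper; lia.
rewrite prednK; last by lia.
(* A chain of length [n] gives its lowest prime growth [n], although that prime contains [x_0^q] and
   [x_1^q]. *)
move=> [P [cP IP]]; have [pr _] := cP.
have [hn' Pn1 _] := pr n (leqnn n).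
have := growth_ge_chain cP (growth_ge0 hn' Pn1); rewrite addn0.
have [h0 _ _] := pr 0%N isT.
by apply: (not_growth_ge_powers h0); apply: IP; [exact: corner_x0|exact: corner_x1].
Qed.

Lemma corner_depth : has_quotient_depth IY n.-1.
Proof.
split.
  exists [seq 'X_i : R | i <- tail]; split.
  - by rewrite size_map size_tail.
  - exact: tail_irrelevant.
  - apply: regular_on_mono_ideal uniq_tail _; first exact: corner_upset.
    exact: corner_free.
rewrite prednK; last by lia.
move=> [fs [sz fm reg]]; apply: (not_growth_ge_powers hIY corner_x0 corner_x1).
have := growth_ge_regular hIY corner_irrelevant fm reg; by rewrite sz.
Qed.

(** A power of [x_2], available since [n >= 2], is a non-zero-divisor modulo the corner ideal. *)
Lemma corner_saturated : is_saturated IY.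
Proof.
move=> f k h; pose i2 : 'I_n.+1 := inord 2.
have it : i2 \in tail by rewrite mem_tail inordK.
apply: (mono_ideal_nzd (k := (U_(i2) *+ k)%MM)).
  elim: (k) => [|k' IH] m; first by rewrite mulm0n add0m.
  by rewrite mulmS -addmA => /(corner_free it) /IH.
by apply: h; rewrite dhomogX; apply/eqP; rewrite /= mdegMn mdeg1 mul1n.
Qed.

Lemma corner_numerically_ACM J : is_homogeneous_ideal J ->
  (forall j, (b j <= j.+1)%N) -> (forall j, hvector J j = (b j)%:Z) -> numerically_ACM J.
Proof.
move=> hJ ble hb; split=> //; exists IY; split.
- exact/mono_ideal_homogeneous/corner_upset.
- exact: corner_saturated.
- by split; [exact: corner_height2|exact: corner_not_height3].
- by exists n.-1; split; [exact: corner_dim|exact: corner_depth].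
(* Iterated differences are injective, so equal h-vectors give equal Hilbert functions. *)
- move=> j; have e : hvector J = hvector IY.
    by apply: funext => i; rewrite hb corner_hvector.
  by have /(congr1 (@^~ j)) [] := iter_diff_inj e.
Qed.

End CornerACM.
End ACM.

(** * The algorithm *)

Section Nonvanishing.
Variables (K : fieldType) (hK : infinite_set (@setT K)).

Lemma poly_nonroot (p : {poly K}) : p != 0 -> exists t, p.[t] != 0.
Proof.
move=> p0; apply: contrapT => h.
have [B _ sB] := infinite_set_fset (size p) hK.
have : (size (finmap.enum_fset B) < size p)%N.
  apply: max_poly_roots => //; last exact: finmap.fset_uniq.
  by apply/allP => t _; apply: contrapT => /negP pt; apply: h; exists t.
by rewrite ltnNge sB.
Qed.

Lemma digits_inj B k (f g : nat -> nat) :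
  (forall i, (f i < B)%N) -> (forall i, (g i < B)%N) ->
  (\sum_(i < k) f i * B ^ i = \sum_(i < k) g i * B ^ i)%N ->
  forall i, (i < k)%N -> f i = g i.
Proof.
elim: k f g => // k IH f g fB gB.
have rec (h : nat -> nat) : (\sum_(i < k.+1) h i * B ^ i =
    (\sum_(i < k) h i.+1 * B ^ i) * B + h 0)%N.
  rewrite big_ord_recl expn0 muln1 addnC; congr (_ + _)%N.
  by rewrite big_distrl /=; apply: eq_bigr => i _; rewrite expnSr mulnA.
have B0 : (0 < B)%N by apply: leq_ltn_trans (fB 0%N).
rewrite !rec => e.
have e0 : f 0%N = g 0%N.
  by have := congr1 (modn^~ B) e; rewrite !modnMDl !modn_small.
have e1 : (\sum_(i < k) f i.+1 * B ^ i = \sum_(i < k) g i.+1 * B ^ i)%N.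
  by move/eqP: e; rewrite e0 eqn_add2r eqn_pmul2r // => /eqP.
case=> [|i] ik //; exact: (IH (fun i => f i.+1) (fun i => g i.+1)).
Qed.

(* Kronecker substitution X_i := t^(B^i) keeps distinct monomials distinct. *)
Lemma mpoly_nonvanishing n (F : {mpoly K[n]}) : F != 0 -> exists u, F.@[u] != 0.
Proof.
move=> F0; pose B := msize F; pose kap (m : 'X_{1..n}) := (\sum_(i < n) m i * B ^ i)%N.
pose p : {poly K} := \sum_(m <- msupp F) F@_m *: 'X^(kap m).
have kap_inj m m' : m \in msupp F -> m' \in msupp F -> kap m = kap m' -> m = m'.
  move=> mF m'F e; apply/mnmP => i.
  have le (k : 'X_{1..n}) : k \in msupp F -> forall j, (nth 0%N k j < B)%N.
    move=> kF j; have kB := msize_mdeg_lt kF; have [jn|nj] := ltnP j n.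
      apply: leq_ltn_trans kB; rewrite -(mnm_nth 0%N k (Ordinal jn)) mdegE.
      by rewrite (bigD1 (Ordinal jn)) //= leq_addr.
    by rewrite nth_default ?size_tuple // (leq_ltn_trans _ kB).
  rewrite !(mnm_nth 0%N); apply: (digits_inj (le _ mF) (le _ m'F) (k := n)) => //.
  by under eq_bigr do rewrite -mnm_nth; under [RHS]eq_bigr do rewrite -mnm_nth.
have lF := mlead_supp F0.
have p0 : p != 0.
  apply/eqP => /(congr1 (fun p : {poly K} => p`_(kap (mlead F)))).
  rewrite coef0 coef_sum (bigD1_seq (mlead F)) ?msupp_uniq //= coefZ coefXn eqxx mulr1.
  rewrite big_seq_cond big1 ?addr0.
    by move/eqP; rewrite mleadc_eq0 (negPf F0).
  move=> m /andP[mF mF']; rewrite coefZ coefXn; case: (kap (mlead F) =P kap m) => [e|_].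
    by rewrite (kap_inj _ _ lF mF e) eqxx in mF'.
  by rewrite mulr0.
have [t pt] := poly_nonroot p0; exists (fun i => t ^+ (B ^ i)).
rewrite mevalE; congr (_ != 0): pt; rewrite /p horner_sum; apply: eq_bigr => m _.
rewrite hornerZ hornerXn; congr (_ * _); rewrite expr_sum; apply: eq_bigr => i _.
by rewrite mulnC exprM.
Qed.

End Nonvanishing.

(** * The effect of one step on the h-vector, and the genericity of [L] *)

Section Step.
Variables (K : fieldType) (n : nat).
Local Notation R := {mpoly K[n.+1]}.
Local Notation mnm := 'X_{1..n.+1}.
Implicit Types (I J Q : set R).

Definition principal (L : R) : set R := [set f | exists q, f = q * L].

Lemma principal_homogeneous L d : L \is d.-homog -> is_homogeneous_ideal (principal L).
Proof.
move=> hL; split.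
  split; first by exists 0; rewrite mul0r.
    by move=> _ _ [q ->] [r ->]; exists (q + r); rewrite mulrDl.
  by move=> r _ [q ->]; exists (r * q); rewrite mulrA.
move=> _ [q ->] e; have [ed|de] := ltnP e d.
  by exists 0; rewrite (pihomogM_lt _ hL ed) mul0r.
by exists (pihomog mdeg (e - d) q); rewrite -{1}(subnK de) (pihomogM _ _ hL).
Qed.

Lemma double_link_homogeneous I L F d e : is_homogeneous_ideal I ->
  L \is d.-homog -> F \is e.-homog -> is_homogeneous_ideal (double_link I L F).
Proof.
move=> [hI gI] hL hF; split.
  split.
  - by exists 0; [exact: ideal0|exists 0; rewrite mulr0 mul0r addr0].
  - move=> _ _ [g Ig [r ->]] [g' Ig' [r' ->]]; exists (g + g'); first exact: idealD.
    by exists (r + r'); rewrite mulrDl mulrDr addrACA.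
  - move=> s _ [g Ig [r ->]]; exists (s * g); first exact: idealM.
    by exists (s * r); rewrite mulrDr mulrCA [s * (r * F)]mulrA.
move=> _ [g Ig [r ->]] j; rewrite pihomogD mulrC.
have [g' Ig' ->] : exists2 g', I g' & pihomog mdeg j (g * L) = L * g'.
  have [jd|dj] := ltnP j d.
    by exists 0; [exact: ideal0|rewrite (pihomogM_lt _ hL jd) mulr0].
  exists (pihomog mdeg (j - d) g); first exact: gI.
  by rewrite -{1}(subnK dj) (pihomogM _ _ hL) mulrC.
have [_ /(_ (r * F) _ j) []] := principal_homogeneous hF; first by exists r.
by move=> r' ->; exists g' => //; exists r'.
Qed.

Definition coprime_mod (L F : R) : Prop :=
  forall r g, r * F = g * L -> principal L r.

(** Three exact sequences are combined: [L] on [R], then [F] on [R/(L)], then [L] on [R/J]. *)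
Lemma hvector_double_link I L F d : (2 <= n)%N -> is_homogeneous_ideal I ->
  L \is 1.-homog -> L != 0 -> I F -> F \is d.-homog -> coprime_mod L F ->
  hvector (double_link I L F) = step_seq (hvector I) d.
Proof.
move=> n2 [hI gI] hL L0 IF hF cop.
pose Z : set R := mono_ideal set0.
have hZ : is_homogeneous_ideal Z by apply: mono_ideal_homogeneous; exact: upset0.
pose P := principal L; have hP : is_homogeneous_ideal P := principal_homogeneous hL.
pose Q : set R := ideal_adjoin P F.
have hQ : is_ideal Q by apply: ideal_adjoin_is_ideal; exact: hP.1.
pose J := double_link I L F.
have hJ : is_homogeneous_ideal J by exact: (double_link_homogeneous (conj hI gI) hL hF).
have eZ : hilbZ Z = shift_seq 1 (hilbZ Z) \+ hilbZ P.
  apply: (hilbZ_exact hZ.1 hZ hP.1 hL).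
    move=> g; split=> /mono_ideal0; last by move=> ->; rewrite mulr0; apply/mono_ideal0.
    by move/eqP; rewrite mulf_eq0 (negPf L0) => /eqP /mono_ideal0.
  move=> f; split=> [[q ->]|[q /mono_ideal0/subr0_eq ->]]; last by exists q.
  by exists q; apply/mono_ideal0; rewrite subrr.
have eP : hilbZ P = shift_seq d (hilbZ P) \+ hilbZ Q.
  apply: (hilbZ_exact hP.1 hP hQ hF) => // g; split=> [[q]|[q ->]].
    by rewrite mulrC => /cop.
  by exists (F * q); rewrite mulrA.
have eJ : hilbZ J = shift_seq 1 (hilbZ I) \+ hilbZ Q.
  apply: (hilbZ_exact hI hJ hQ hL).
    move=> g; split=> [[g' Ig' [r]]|Ig]; last by exists g => //; exists 0; rewrite mul0r addr0.
    (* From [L g = L g' + r F] coprimality gives [r = r' L]; cancelling [L] leaves [g = g' + r' F],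
       which is in [I] because [F] is. *)
    move=> e; have [r' er] : principal L r.
      by apply: (cop _ (g - g')); rewrite mulrBl [g * L]mulrC e [g' * L]mulrC addrC addKr.
    have -> : g = g' + r' * F.
      by apply: (mulfI L0); rewrite e er mulrDr -mulrA mulrCA.
    by apply: (idealD hI) => //; exact: (idealM hI).
  move=> f; split=> [[b [a e]]|[q [g Ig [r e]]]].
    exists a; exists 0; first exact: (ideal0 hI).
    by exists b; rewrite mulr0 add0r -e opprB addrCA subrr addr0.
  exists r, (g + q); rewrite mulrDl [g * L]mulrC.
  by apply/eqP; rewrite subr_eq addrAC -e subrK.
have hv0 j : iter n.-1 diff (hilbZ Z) j = j.+1%:Z := hvector_zero K n2 j.
have hvP j : iter n.-1 diff (hilbZ P) j = 1.
  have := congr1 (@^~ j) (congr1 (iter n.-1 diff) eZ).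
  rewrite /= iter_diffD iter_diff_shift /= /shift_seq !hv0.
  by case: j => [|j] /=; rewrite ?hv0 ?subSS ?subn0; lia.
have hvE (A : set R) : hvector A = iter n.-1 diff (hilbZ A) by [].
apply: funext => j; have := congr1 (@^~ j) (congr1 (iter n.-1 diff) eP).
have := congr1 (@^~ j) (congr1 (iter n.-1 diff) eJ).
rewrite /= !iter_diffD !iter_diff_shift /= /shift_seq !hvP !hvE => ->.
rewrite /step_seq; case: j => [|j]; case: ltnP => _ /=; rewrite ?subSS ?subn0; lia.
Qed.

Lemma linear_form_homog v : @linear_form K n v \is 1.-homog.
Proof.
rewrite rpred_sum // => i _; rewrite rpredZ // dhomogX; apply/eqP; exact: mdeg1.
Qed.

Lemma linear_formE v w : (@linear_form K n v).@[w] = \sum_i v i * w i.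
Proof. by rewrite raddf_sum /=; apply: eq_bigr => i _; rewrite mevalZ mevalXU. Qed.

Lemma mcoeff_linear_form v i : (@linear_form K n v)@_U_(i) = v i.
Proof.
rewrite raddf_sum /= (bigD1 i) //= big1 ?addr0.
  by rewrite mcoeffZ mcoeffXU eqxx mulr1.
by move=> j /negPf ji; rewrite mcoeffZ mcoeffXU ji mulr0.
Qed.

(** A pointwise witness that [L] does not divide [F]; the condition on [v ord0] lets [x_0] be
    eliminated. *)
Definition transversal (v : 'I_n.+1 -> K) (F : R) : Prop :=
  v ord0 != 0 /\ exists w, (linear_form v).@[w] = 0 /\ F.@[w] != 0.

(* R/(L) is a domain: eliminating X_0 is a retraction with kernel (L). *)
Lemma transversal_coprime v F : transversal v F -> coprime_mod (linear_form v) F.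
Proof.
move=> [v0 [w [Lw Fw]]]; set L := linear_form v in Lw *; pose P := principal L.
have hP : is_ideal P by have [] := principal_homogeneous (linear_form_homog v).
(* This is [x_0] solved from [L = 0] in terms of the other variables. *)
pose l : R := 'X_ord0 - (v ord0)^-1 *: L.
pose phi (f : R) : R := f \mPo [tuple if i == ord0 then l else 'X_i | i < n.+1].
have phiX i : phi 'X_i = if i == ord0 then l else 'X_i.
  by rewrite /phi comp_mpolyXU -tnth_nth tnth_mktuple.
have PX i : P ('X_i - phi 'X_i).
  rewrite phiX; case: eqP => [->|_]; last by rewrite subrr; exact: ideal0.
  by rewrite /l opprB addrCA subrr addr0; exists ((v ord0)^-1%:MP); rewrite mul_mpolyC.
have PM f g : P (f - phi f) -> P (g - phi g) -> P (f * g - phi (f * g)).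
  move=> Pf Pg; rewrite (_ : _ - _ = f * (g - phi g) + (f - phi f) * phi g).
    by apply: (idealD hP); [exact: (idealM hP)|exact: (idealMr hP)].
  by rewrite /phi rmorphM /= mulrBr mulrBl addrA subrK.
have Pphi f : P (f - phi f).
  have -> : f - phi f = \sum_(m <- msupp f) f@_m *: ('X_[m] - phi 'X_[m]).
    under eq_bigr => m _ do rewrite scalerBr.
    rewrite sumrB -mpolyE; congr (_ - _).
    by rewrite {1}(mpolyE f) /phi raddf_sum; apply: eq_bigr => m _; rewrite /= linearZ.
  apply: (ideal_sum hP) => m _; apply: (idealZ hP).
  rewrite mpolyXE_id; apply: (big_ind (fun f => P (f - phi f))) => [|//|i _].
    by rewrite /phi rmorph1 subrr; exact: (ideal0 hP).
  elim: (m i) => [|k IH]; first by rewrite expr0 /phi rmorph1 subrr; exact: (ideal0 hP).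
  by rewrite exprS; exact: PM.
have phiL : phi L = 0.
  have -> : phi L = \sum_i v i *: phi 'X_i.
    rewrite /L /linear_form /phi raddf_sum; apply: eq_bigr => i _; by rewrite /= linearZ.
  have eL : v ord0 *: l = - \sum_(i | i != ord0) v i *: 'X_i.
    rewrite /l scalerBr scalerA divff // scale1r /L /linear_form (bigD1 ord0) //= opprD addrA.
    by rewrite subrr add0r.
  rewrite (bigD1 ord0) //= phiX eqxx eL.
  rewrite [X in _ + X](eq_bigr (fun i => v i *: 'X_i)) ?addNr // => i i0.
  by rewrite phiX (negPf i0).
have evP f : P f -> f.@[w] = 0 by move=> [q ->]; rewrite mevalM Lw mulr0.
(* Modulo [L] nothing changes under [phi], so [phi F] still takes the nonzero value of [F] at [w],
   and [phi r] must be 0. *)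
move=> r g e; have /eqP : phi r * phi F = 0.
  by rewrite -rmorphM e rmorphM /= -/(phi L) phiL mulr0.
rewrite mulf_eq0 => /orP[/eqP r0|/eqP pF0].
  by have := Pphi r; rewrite r0 subr0.
by have := evP _ (Pphi F); rewrite pF0 subr0 => FW; rewrite FW eqxx in Fw.
Qed.

(** A union of nonvanishing loci of polynomials certifying transversality: open by construction, so
    that the work lies in showing it nonempty. *)
Definition general_forms (I : set R) (F : R) : set ('I_n.+1 -> K) :=
  [set v | exists2 p : R, (forall v', p.@[v'] != 0 -> F != 0 -> transversal v' F)
                        & p.@[v] != 0].

Lemma general_forms_generic : infinite_set (@setT K) -> (1 <= n)%N ->
  genericity_condition general_forms.
Proof.
move=> hK n1 I F; split.
  by exists [set p : R | forall v', p.@[v'] != 0 -> F != 0 -> transversal v' F].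
have [->|F0] := eqVneq F 0.
  by exists (fun=> 0); exists 1; [move=> v' _; rewrite eqxx|rewrite meval1 oner_neq0].
pose i1 : 'I_n.+1 := inord 1.
have i10 : i1 != ord0 by rewrite -val_eqE /= inordK.
have [u] : exists u, ('X_i1 * F).@[u] != 0.
  apply: mpoly_nonvanishing => //; rewrite mulf_neq0 //.
  by rewrite -msize_poly_eq0 msizeX.
rewrite mevalM mevalXU mulf_eq0 negb_or => /andP[u1 Fu].
(* For every v, the point w(v) lies on the hyperplane of the form with coefficients v. *)
pose w : n.+1.-tuple R := [tuple if i == ord0 then - \sum_(j | j != ord0) u j *: 'X_j
  else u i *: 'X_ord0 | i < n.+1].
pose W v i := (tnth w i).@[v].
have W0 v : W v ord0 = - \sum_(j | j != ord0) u j * v j.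
  rewrite /W tnth_mktuple eqxx mevalN; congr (- _).
  rewrite raddf_sum /=; apply: eq_bigr => j _; by rewrite mevalZ mevalXU.
have Wi v i : i != ord0 -> W v i = u i * v ord0.
  by move=> i0; rewrite /W tnth_mktuple (negPf i0) mevalZ mevalXU.
(* Its value at [v] is [v ord0 * F(W v)], so nonvanishing yields both clauses of [transversal]. *)
pose p : R := 'X_ord0 * (F \mPo w).
have pE v : p.@[v] = v ord0 * F.@[W v] by rewrite mevalM mevalXU comp_mpoly_meval.
(* A form vanishing at [u], normalised at [x_0] so that [W v] is [u] itself. *)
exists (fun i => if i == ord0 then 1 else if i == i1 then - u ord0 / u i1 else 0).
exists p.
  move=> v; rewrite pE mulf_eq0 negb_or => /andP[v0 Fv] _; split=> //.
  exists (W v); split=> //; rewrite linear_formE (bigD1 ord0) //= W0 mulrN mulr_sumr.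
  apply/eqP; rewrite addrC subr_eq0; apply/eqP; apply: eq_bigr => i i0.
  by rewrite Wi // mulrA mulrC [v i * _]mulrC.
rewrite pE eqxx mul1r; congr (_ != 0): Fu; apply: meval_eq => i.
have [->|i0] := eqVneq i ord0; last by rewrite Wi // eqxx mulr1.
rewrite W0 (bigD1 i1) //= (negPf i10) eqxx big1 ?addr0.
  by rewrite mulrC mulfVK ?opprK.
by move=> j /andP[/negPf -> /negPf ->]; rewrite mulr0.
Qed.

End Step.

(** * The invariant of the algorithm, termination, and the resulting ideal *)

Section Algorithm.
Variables (K : fieldType) (n : nat).
Hypotheses (hK : infinite_set (@setT K)) (hn : (2 <= n)%N).
Local Notation R := {mpoly K[n.+1]}.
Implicit Types (I J : set R).
Local Notation U := (@general_forms K n).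

(** The invariant preserved by every step. The form [G] of degree [s] ensures that forms [F] of the
    required degree exist. *)
Definition stair_ideal I (s N : nat) : Prop :=
  [/\ is_homogeneous_ideal I, stair (hvector I) s N
    & exists G, [/\ I G, G != 0 & G \is s.-homog]].

Lemma stair_ideal_init I : is_homogeneous_ideal I -> height_ge I 2 ->
  (forall l : R, l \is 1.-homog -> I l -> l = 0) -> exists s N, stair_ideal I s N.
Proof.
move=> [hI gI] ht hlin.
pose P s := `[< exists G, [/\ I G, G != 0 & G \is s.-homog] >].
have exP : exists s, P s.
  have [G [IG G0 _]] := height2_elimination ord0 hI ht.
  exists (mdeg (mlead G)); apply/asboolP; exists (pihomog mdeg (mdeg (mlead G)) G).
  split; [exact: gI| |exact: pihomogP].
  apply: contraNneq G0 => e; rewrite -mleadc_eq0.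
  by have := mcoeff_pihomog (mdeg (mlead G)) G (mlead G); rewrite e eqxx mcoeff0 => <-.
have [s /asboolP[G [IG G0 hG]] smin] := ex_minnP exP.
(* In degree 0 the ideal would be the unit ideal, which contains the linear form [x_0]. *)
have s0 : (0 < s)%N.
  rewrite lt0n; apply/eqP => s0; rewrite s0 in hG.
  have lG : mdeg (mlead G) = 0%N by apply: (dhomog_mf hG); exact: mlead_supp.
  have GC : G = (G@_0%MM)%:MP by apply: msize1_polyC; rewrite -mlead_deg // lG.
  have c0 : G@_0%MM != 0 by apply: contraNneq G0 => c0; rewrite GC c0 mpolyC0.
  have IX : I 'X_ord0.
    rewrite -(scalerK c0 'X_ord0); apply: (idealZ hI).
    by rewrite -mul_mpolyC -GC; exact: (idealMr hI).
  have hX : ('X_ord0 : R) \is 1.-homog by rewrite dhomogX; apply/eqP; exact: mdeg1.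
  by have /eqP := hlin _ hX IX; rewrite -msize_poly_eq0 msizeX.
have small j (k : 'X_{1..n.+1}) : (j < s)%N -> mdeg k = j -> ~ lead_set I k.
  move=> js kj [f [If hf fk _]]; have : P j.
    apply/asboolP; exists f; split=> //; last by rewrite -kj.
    by apply: contraNneq fk => ->; rewrite mcoeff0.
  by move/smin; rewrite leqNgt js.
pose Z : set R := mono_ideal set0.
have hZ : is_ideal Z by apply: mono_ideal_is_ideal; exact: upset0.
have eq_lt j : (j < s)%N -> hilbZ I j = hilbZ Z j.
  move=> js; rewrite /hilbZ (hilbertE hI (graded_quotient_dim_lead j hI)).
  rewrite (hilbertE hZ (graded_quotient_dim_lead j hZ)) lead_set_mono.
  congr Posz; apply: eq_card => k; rewrite !inE; case: eqP => //= kj.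
  by apply/asbool_equiv_eq; split=> _; [by []|exact: (small _ _ js kj)].
(* The leading monomial of [G] is no longer standard. *)
have lt_s : hilbZ I s < hilbZ Z s.
  rewrite /hilbZ (hilbertE hI (graded_quotient_dim_lead s hI)).
  rewrite (hilbertE hZ (graded_quotient_dim_lead s hZ)) lead_set_mono ltz_nat.
  have dG : mdeg (mlead G) = s by apply: (dhomog_mf hG); exact: mlead_supp.
  have lG : (mdeg (mlead G) < s.+1)%N by rewrite dG.
  apply: proper_card; apply/properP; split.
    apply/fintype.subsetP => k; rewrite !inE => /andP[-> _] /=.
    by apply/asboolP.
  exists (BMultinom lG); rewrite !inE /= dG eqxx /=; first by apply/asboolP.
  apply/asboolPn => nS; apply: nS; exists G; split=> //.
  - by rewrite dG.
  - by rewrite mleadc_eq0.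
  - by move=> m; rewrite -mcoeff_msupp; exact: msupp_le_mlead.
have [N hN] : eventually_zero (hvector I).
  apply: eventually_zero_hvector => //; first exact: ltnW.
  by move=> i; exact: height2_elimination.
exists s, N; split=> //; last by exists G.
split=> // [j js|].
  rewrite -(hvector_zero K hn j); apply: iter_diff_local => i ij.
  by apply: eq_lt; exact: leq_ltn_trans js.
have := iter_diff_delta n.-1 eq_lt.
by rewrite -/(hvector I s) -/(hvector Z s) hvector_zero //; lia.
Qed.

Lemma stair_ideal_step I s N F J : stair_ideal I s N -> algorithm_step U I F J ->
  exists i, [/\ first_jump (hvector I) i, F != 0, F \is i.+2.-homog,
    hvector J = step_seq (hvector I) i.+2 & stair_ideal J s.+1 N.+1].
Proof.
move=> [hI st [G [IG G0 hG]]] [_ [i [v [ji [IF F0]]]]].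
rewrite addn2 => hF [p hp pv] ->; exists i.
have tr := hp v pv F0; have cop := transversal_coprime tr.
have hL := linear_form_homog v.
have L0 : linear_form v != 0 :> R.
  by apply: contraNneq tr.1 => e; rewrite -(mcoeff_linear_form v ord0) e mcoeff0.
have hv := hvector_double_link hn hI hL L0 IF hF cop.
split=> //; split; [exact: (double_link_homogeneous hI hL hF)|by rewrite hv; exact: stair_step|].
exists (linear_form v * G); split; last by have := dhomogM hL hG; rewrite add1n.
  by exists G => //; exists 0; rewrite mul0r addr0.
by rewrite mulf_neq0.
Qed.

Lemma stair_ideal_run I Fs J s N : stair_ideal I s N -> algorithm_run U I Fs J ->
  exists s' N', stair_ideal J s' N'.
Proof.
move=> st run; elim: run s N st => {I Fs J} [I|I F J Fs J' stp _ IH] s N st.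
  by exists s, N.
by have [i [_ _ _ _ /IH]] := stair_ideal_step st stp.
Qed.

Lemma stair_ideal_continue I s N : stair_ideal I s N -> ~ O_sequence (hvector I) ->
  exists F J, algorithm_step U I F J.
Proof.
move=> [hI st [G [IG G0 hG]]] nO.
have [i ji] : exists i, first_jump (hvector I) i.
  apply: stair_first_jump; apply: contrapT => nj; apply: nO.
  by apply: (nojump_O_sequence st) => i ji; apply: nj; exists i.
have si := stair_jump_ge st ji.1.
(* As [s <= i], a power of [x_0] lifts [G] to degree [i + 2]. *)
pose F : R := 'X_[U_(ord0) *+ (i + 2 - s)] * G.
have [_ [v Uv]] := general_forms_generic hK (ltnW hn) I F.
exists F, (double_link I (linear_form v) F); split=> //.
exists i, v; split=> //; split.
- by apply: idealM => //; exact: hI.1.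
- by rewrite mulf_neq0 // -msize_poly_eq0 msizeX.
- have -> : (i + 2 = (i + 2 - s) + s)%N by lia.
  by apply: dhomogM => //; rewrite dhomogX; apply/eqP; rewrite /= mdegMn mdeg1 mul1n.
Qed.

Lemma stair_ideal_terminates I s N : stair_ideal I s N -> ~ infinite_run U I.
Proof.
move=> st [Is [Fs [e0 stp]]].
(* Each step lowers the excess by at least 1, so the initial excess bounds the number of steps. *)
have main k : exists s' N', stair_ideal (Is k) s' N' /\
    (excess (hvector (Is k)) s' N' + k <= excess (hvector I) s N)%N.
  elim: k => [|k [s' [N' [st' le]]]]; first by exists s, N; rewrite e0 addn0.
  have [i [ji _ _ hv st'']] := stair_ideal_step st' (stp k).
  exists s'.+1, N'.+1; split=> //; rewrite hv; have [_ st1 _] := st'.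
  have := excess_step st1 ji; lia.
by have [s' [N' [_]]] := main (excess (hvector I) s N).+1; lia.
Qed.

(** The bound [b] on the jumps drives the induction: a step at [i >= b] uses degree [i + 2 > b + 1]
    and leaves only jumps from [i + 1] on, which is the next bound. *)
Lemma stair_ideal_degrees I Fs J s N b : stair_ideal I s N -> algorithm_run U I Fs J ->
  (forall i, jump (hvector I) i -> (b <= i)%N) ->
  path ltn b.+1 [seq form_degree F | F <- Fs].
Proof.
move=> st run; elim: run s N b st => {I Fs J} [//|I F J Fs J' stp _ IH] s N b st hb /=.
have [i [ji F0 hF hv st']] := stair_ideal_step st stp.
have -> : form_degree F = i.+2.
  rewrite /form_degree -mlead_deg //=; apply: (dhomog_mf hF); exact: mlead_supp.
rewrite ltnS ltnS hb; last exact: ji.1.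
apply: (IH _ _ _ st') => k; rewrite hv; have [_ st1 _] := st.
exact: first_jump_step st1 ji.
Qed.

Lemma stair_ideal_ACM I s N : stair_ideal I s N -> O_sequence (hvector I) ->
  numerically_ACM I.
Proof.
move=> [hI [s0 lt_s le_s hN] _] /O_sequence_noninc[b [ab b0 bni]].
have bN : b N = 0%N by apply/eqP; rewrite -eqz_nat -ab hN.
(* The remaining bound [b j <= j + 1] is an equality below [s], and later follows from
   [b j <= b s <= s]. *)
apply: (corner_numerically_ACM hn bni b0 bN hI _ ab) => j.
have bs : (b s <= s)%N by rewrite -lez_nat -ab.
have [js|sj] := ltnP j s; first by rewrite -lez_nat -ab lt_s.
by have := noninc_from bni bs sj; lia.
Qed.

End Algorithm.

Theorem proposition4p8 (K : fieldType) (n : nat)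
  (hK : infinite_set (@setT K)) (hn : (2 <= n)%N)
  (I : set {mpoly K[n.+1]})
  (hI : is_homogeneous_ideal I) (hht : height_ge I 2)
  (hlin : forall l : {mpoly K[n.+1]}, l \is 1.-homog -> I l -> l = 0%R) :
  exists U : set {mpoly K[n.+1]} -> {mpoly K[n.+1]} -> set ('I_n.+1 -> K),
    genericity_condition U /\
    (* the algorithm can always be continued until it stops, and it stops *)
    (forall Fs J, algorithm_run U I Fs J -> ~ O_sequence (hvector J) ->
       exists F J', algorithm_step U J F J') /\
    ~ infinite_run U I /\
    (* the resulting ideal is numerically ACM *)
    (forall Fs J', algorithm_run U I Fs J' -> O_sequence (hvector J') ->
       numerically_ACM J') /\
    (* the degrees of the forms used are strictly increasing *)
    (forall Fs J, algorithm_run U I Fs J ->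
       sorted ltn [seq form_degree F | F <- Fs]).
Proof.
have [s [N st]] := stair_ideal_init hn hI hht hlin.
exists (@general_forms K n); split; first exact: general_forms_generic (ltnW hn).
split=> [Fs J /(stair_ideal_run hn st)[s' [N' st']]|].
  exact: stair_ideal_continue st'.
split; first exact: stair_ideal_terminates st.
split=> [Fs J /(stair_ideal_run hn st)[s' [N' st']]|Fs J run].
  exact: stair_ideal_ACM st'.
by apply: path_sorted (stair_ideal_degrees (b := 0) hn st run _).
Qed.
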